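(* Let $\phi:[0,1]\to[0,1]$ be given by $\phi(0)=1$ and $\phi(x)=x\log x-x+1$ for $x\in(0,1]$ (so $\phi$ is continuous and strictly decreasing from $1$ to $0$, and $\phi^{-1}:[0,1]\to[0,1]$ denotes its inverse). For $a\in(0,1/4)$ and $B\in[0,\phi^{-1}(4a)]$ let $$W(a,B):=\frac{\big(\phi(B)-\sqrt{\phi(B)^2-4a\,\phi(B)}\big)^2}{4\phi(B)}+a\,\frac{\phi(\min\{1,2B\})}{\phi(B)},$$ and define $K(a):=\min_{B\in[0,\phi^{-1}(4a)]}W(a,B)$ for $a\in(0,1/4)$. Then for every $a\in(0,1/4)$ we have $\psi(a)\le K(a)$. Moreover, $K(a)<a$ for all $a\in(0,0.11717]$, and $K(a)\le \frac{2a^2}{1-\log 2}+o(a^2)$ as $a\to0^+$.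
   Context: For $A\subseteq\mathbb N$ and $x\ge1$, let $\operatorname{R}_x(A):=1-\frac{\#(A\cap[1,x])}{x}$, and let $A\cdot A:=\{a_1a_2: a_1,a_2\in A\}$. For $a>0$ define $$\psi(a):=\sup\Big\{b\in\mathbb R_{>0}\ \Big|\ \operatorname{R}_x(A\cdot A)\ll(\log x)^{-b}\text{ for every } A\subseteq\mathbb N \text{ such that } \operatorname{R}_x(A)\ll(\log x)^{-a}\Big\},$$ where the implicit constants in $\ll$ may depend on $A$ (and $b$), and the bounds are meant for all sufficiently large $x$. *)

(* Defs.v *)
From HB Require Import structures.
From mathcomp Require Import all_boot all_order all_algebra.
From mathcomp Require Import finmap.
From mathcomp Require Import all_classical all_reals all_analysis.
From mathcomp Require Import ring lra.

Set Implicit Arguments.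
Unset Strict Implicit.
Unset Printing Implicit Defensive.

Import Order.TTheory GRing.Theory Num.Theory.
Import numFieldNormedType.Exports.

Local Open Scope classical_set_scope.
Local Open Scope ring_scope.

(* [nat] contains 0, but 0 never contributes to the counts below, neither from
   A nor from A.A. *)
Definition count_upto (R : realType) (A : set nat) (x : R) : nat :=
  #|` fset_set (A `&` [set n : nat | 1 <= (n%:R : R) <= x])|.

Lemma finite_upto (R : realType) (A : set nat) (x : R) :
  finite_set (A `&` [set n : nat | 1 <= (n%:R : R) <= x]).
Proof.
apply: (@sub_finite_set _ _ `I_((Num.truncn x).+1)); last exact: finite_II.
move=> n /= [_ /andP[n1 nx]].
have x0 : 0 <= x by apply: le_trans nx.
by rewrite ltnS truncn_ge_nat.
Qed.

Definition rel_compl (R : realType) (A : set nat) (x : R) : R :=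
  1 - (count_upto A x)%:R / x.

Definition prodset (A : set nat) : set nat :=
  [set (a1 * a2)%N | a1 in A & a2 in A].

(* R_x(A) << (log x)^-c as x -> +oo; the constant may depend on A and c. *)
Definition compl_ll (R : realType) (A : set nat) (c : R) : Prop :=
  exists C : R, \forall x \near +oo, `|rel_compl A x| <= C * ln x `^ (- c).

(* The supremum is taken in the extended reals, so that it does not rely on the
   set of exponents being bounded or nonempty. *)
Definition psi (R : realType) (a : R) : \bar R :=
  ereal_sup (EFin @` [set b : R | 0 < b /\
    forall A : set nat, compl_ll A a -> compl_ll (prodset A) b]).

Definition phi (R : realType) (x : R) : R :=
  if x == 0 then 1 else x * ln x - x + 1.

Lemma phiE (R : realType) (x : R) : phi x = x * ln x - x + 1.
Proof. by rewrite /phi; case: eqVneq => // ->; lra. Qed.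

Lemma phi0 (R : realType) : phi (0 : R) = 1. Proof. by rewrite /phi eqxx. Qed.

Lemma phi1 (R : realType) : phi (1 : R) = 0. Proof. by rewrite phiE ln1; lra. Qed.

Lemma phi_decr (R : realType) : {in `[0, 1] &, {homo @phi R : x y /~ x < y}}.
Proof.
have tangent (x y : R) : 0 < x -> 0 < y -> (x - y) * ln y <= phi x - phi y.
  move=> x0 y0; rewrite !phiE.
  have : ln (1 + (y / x - 1)) <= y / x - 1.
    by apply: le_ln1Dx; have := divr_gt0 y0 x0; lra.
  rewrite addrC subrK ln_div// -(ler_pM2l x0) !mulrBr mulrCA divff ?gt_eqF//.
  by lra.
have lt1 (x y : R) : 0 <= x -> x < y -> y < 1 -> phi y < phi x.
  move=> x0 xy y1; have y0 : 0 < y by lra.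
  have lny : ln y < 0 by apply: ln_lt0; rewrite y0.
  move: x0; rewrite le_eqVlt => /predU1P[<-|x0].
    by rewrite phi0 phiE; have := nmulr_llt0 y lny; rewrite y0; lra.
  have := tangent _ _ x0 y0; have : 0 < (x - y) * ln y by rewrite nmulr_lgt0//; lra.
  lra.
move=> y x; rewrite !in_itv/= => /andP[y0 y1] /andP[x0 x1] xy.
move: y1 xy; rewrite le_eqVlt => /predU1P[->|y1] xy; last exact: lt1.
have z0 : 0 < (x + 1) / 2 by lra.
have z1 : (x + 1) / 2 < 1 by lra.
apply: le_lt_trans (lt1 x ((x + 1) / 2) _ _ _); [|lra..].
have := tangent _ _ z0 (@ltr01 R); rewrite ln1; lra.
Qed.

Lemma xlnx_cvg0 (R : realType) : x * ln x @[x --> (0 : R)] --> (0 : R).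
Proof.
have csqrt (c : R) : c * Num.sqrt y @[y --> (0 : R)] --> (0 : R).
  rewrite -[X in _ --> X](_ : c * Num.sqrt 0 = 0); last by rewrite sqrtr0 mulr0.
  by apply: cvgM; [exact: cvg_cst|exact: (@sqrt_continuous R 0)].
apply: squeeze_cvgr (csqrt (-2)) (csqrt 2).
near=> y; rewrite mulNr -ler_norml.
have [y0|y0] := leP y 0.
  by rewrite ln0// mulr0 normr0 mulr_ge0// sqrtr_ge0.
have s0 : 0 < Num.sqrt y by rewrite sqrtr_gt0.
have ys : y = Num.sqrt y ^+ 2 by rewrite sqr_sqrtr ?ltW.
have s1 : Num.sqrt y < 1.
  by rewrite -[ltRHS]sqrtr1 ltr_sqrt//; near: y; exact: lt_nbhsl.
rewrite [in X in X <= _]ys; move: (Num.sqrt y) s0 s1 => s s0 s1.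
have lns : ln s < 0 by apply: ln_lt0; rewrite s0.
have : ln s^-1 < s^-1 by apply: ln_sublinear; rewrite invr_gt0.
rewrite lnV// -(ltr_pM2l s0) mulrN divff ?gt_eqF// => h.
rewrite lnXn// normrM ger0_norm ?sqr_ge0// ler0_norm; last by lra.
by nra.
Unshelve. all: by end_near. Qed.

Lemma continuous_phi (R : realType) : continuous (@phi R).
Proof.
have -> : @phi R = fun x => x * ln x - x + 1 by apply/funext => x; exact: phiE.
move=> x; apply: cvgD; last exact: cvg_cst.
apply: cvgB; last exact: cvg_id.
have [x0|x0|->] := ltrgtP x 0.
- rewrite (@ln0 _ x) ?ltW// mulr0; apply: cvg_near_cst.
  near=> y; rewrite ln0 ?mulr0//; apply/ltW; near: y; exact: lt_nbhsl.
- by apply: cvgM; [exact: cvg_id|exact: continuous_ln].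
- by rewrite mul0r; exact: xlnx_cvg0.
Unshelve. all: by end_near. Qed.

Lemma phi_bij (R : realType) : set_bij `[0, 1] `[0, 1] (@phi R).
Proof.
have mono : {in `[0, 1] &, {mono @phi R : x y /~ x <= y}}.
  exact/le_nmono_in/phi_decr.
have i0 : (0 : R) \in `[0, 1] by rewrite in_itv/= lexx ler01.
have i1 : (1 : R) \in `[0, 1] by rewrite in_itv/= lexx ler01.
split.
- move=> x /= xI; rewrite in_itv/= -(phi0 R) -{1}(phi1 R) !mono//.
  by move: xI; rewrite in_itv/= andbC.
- move=> x y /set_mem xI /set_mem yI xy; apply/eqP.
  by rewrite eq_le -(mono _ _ xI yI) -(mono _ _ yI xI) xy lexx.
- move=> y /= yI.
  have [||x xI <-] := @IVT R (@phi R) 0 1 y ler01.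
  + exact/continuous_subspaceT/continuous_phi.
  + by move: yI; rewrite in_itv/= phi0 phi1 min_r ?max_l.
  + by exists x.
Qed.

Definition phi_inv (R : realType) : R -> R := 'pinv_(fun=> 0) `[0, 1] (@phi R).

Lemma phi_inv_itv (R : realType) (y : R) : y \in `[0, 1] -> phi_inv y \in `[0, 1].
Proof.
by move=> yI; have [+ _ _] := bijpinv_bij (fun=> 0) (@phi_bij R); apply.
Qed.

Lemma phi_invK (R : realType) (y : R) : y \in `[0, 1] -> phi (phi_inv y) = y.
Proof.
move=> yI; have [_ _ s] := @phi_bij R.
by apply: (surjpK _ s); rewrite inE.
Qed.

Lemma phiK (R : realType) (x : R) : x \in `[0, 1] -> phi_inv (phi x) = x.
Proof.
move=> xI; have [_ i _] := @phi_bij R.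
by apply: (pinvKV _ i); rewrite inE.
Qed.

Definition W (R : realType) (a B : R) : R :=
  (phi B - Num.sqrt (phi B ^+ 2 - 4 * a * phi B)) ^+ 2 / (4 * phi B)
  + a * (phi (Num.min 1 (2 * B)) / phi B).

(* This infimum is attained: see K_min. *)
Definition K (R : realType) (a : R) : R :=
  inf (W a @` `[0, phi_inv (4 * a)]).

Lemma K_min (R : realType) (a : R) : 0 < a < 1 / 4 ->
  (exists2 B, B \in `[0, phi_inv (4 * a)] & K a = W a B) /\
  forall B : R, B \in `[0, phi_inv (4 * a)] -> K a <= W a B.
Proof.
move=> a14; have I4a : 4 * a \in `[0, 1] by rewrite in_itv/=; lra.
have := phi_inv_itv I4a; rewrite in_itv/= => /andP[b0 b1].
have [|B BI Bmin] := @EVT_min R (W a) 0 (phi_inv (4 * a)) b0.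
  apply: continuous_in_subspaceT => B /set_mem /=.
  rewrite in_itv/= => /andP[B0 Bb].
  have phiB : phi B != 0.
    have : 4 * a <= phi B; last by move=> ?; rewrite gt_eqF//; lra.
    rewrite -(phi_invK I4a) (le_nmono_in (@phi_decr R))// in_itv/= ?b0//.
    by rewrite B0 (le_trans Bb).
  have cphi : phi y @[y --> B] --> phi B by exact: continuous_phi.
  have cmin : phi (Num.min 1 (2 * y)) @[y --> B] --> phi (Num.min 1 (2 * B)).
    apply: (@continuous_comp _ _ _ (fun y : R => Num.min 1 (2 * y)) (@phi R));
      last exact: continuous_phi.
    apply: (@continuous_min R _ (fun=> 1) (fun y : R => 2 * y)).
      exact: cvg_cst.
    by apply: cvgM; [exact: cvg_cst|exact: cvg_id].
  apply: cvgD; last first.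
    by apply: cvgM; [exact: cvg_cst|apply: cvgM => //; exact: cvgV].
  apply: cvgM; last first.
    by apply: cvgV; [rewrite mulf_neq0|apply: cvgM => //; exact: cvg_cst].
  apply: (@continuous_comp _ _ _
    (fun y : R => phi y - Num.sqrt (phi y ^+ 2 - 4 * a * phi y))
    (fun z : R => z ^+ 2));
    last exact: exprn_continuous.
  apply: cvgB => //.
  apply: (@continuous_comp _ _ _ (fun y : R => phi y ^+ 2 - 4 * a * phi y)
    (@Num.sqrt R));
    last exact: sqrt_continuous.
  apply: cvgB; first by rewrite expr2; exact: cvgM.
  by apply: cvgM => //; exact: cvg_cst.
have lbB : lbound (W a @` `[0, phi_inv (4 * a)]) (W a B).
  by move=> _ [y yI <-]; exact: Bmin.
have KB : K a = W a B.
  apply/eqP; rewrite eq_le; apply/andP; split.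
    by apply: ge_inf; [exists (W a B)|exists B].
  by apply: lb_le_inf => //; exists (W a B); exists B.
by split; [exists B|move=> y yI; rewrite KB Bmin].
Qed.

(* Main.v *)
Require Import Defs.
From HB Require Import structures.
From mathcomp Require Import all_boot all_order all_algebra.
From mathcomp Require Import finmap.
From mathcomp Require Import all_classical all_reals all_analysis.
From mathcomp Require Import ring lra zify.

Set Implicit Arguments.
Unset Strict Implicit.
Unset Printing Implicit Defensive.

Import Order.TTheory GRing.Theory Num.Theory.
Import numFieldNormedType.Exports.

Local Open Scope classical_set_scope.
Local Open Scope ring_scope.

(* Let A omit, along a very sparse sequence of scales s, the integers m having at most B w s prime
   factors p with ln ln p <= w s, and also omit every m whose prime factors all satisfy
   ln p > (ln m)^a.  Call n structured at scale s if it has no prime factor with ln ln p <= a w s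
   and at most 2 B w s of them with ln ln p <= w s.  If a structured n is x y, then either one of
   the factors has ln ln <= w s, and its primes are all too large for it to be in A, or one of the
   two has at most B w s primes with ln ln p <= w s, hence is not in A; so n is not in A.A.

   The omitted sets have density O((ln x)^-a) as soon as phi(B) w > a: Rankin's trick together
   with the Hall-Tenenbaum inequality reduces this to Mertens' estimates.  The structured integers
   are bounded below through the Dirichlet series of their indicator function at 1 + exp(-s),
   where Euler products replace a lower-bound sieve.  As w decreases to u = a / phi(B), the
   exponent of their density tends to u (a + (1 - a) phi(min(1, 2 B))), which is at most
   W(a, B). *)

(** * Chebyshev bounds and mean values of submultiplicative functions *)

(** The exponent comes from a Poisson model. Having no prime with [ln ln p <= a w s] costs a factor
    [exp(- a w s)]; the number of the other primes with [ln ln p <= w s] is roughly Poisson of mean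
    [(1 - a) w s], and having only [beta = min(1, 2 B)] times that many costs
    [exp(- phi(beta) (1 - a) w s)]. No pointwise density of the structured integers is needed: were
    the complement of A.A of density [O((ln x)^-b)], its harmonic sum up to
    [ln x = exp((1 + eps) s)] would be [O(exp((1 + eps) (1 - b) s))], and the structured integers
    exceed this for large [s]. The cut-off has to lie beyond [exp(s)] for the tail of the Dirichlet
    series to be negligible. Integers must therefore be omitted from A up to that height, where the
    permitted density is only [exp(- (1 + eps) a s)]; this is why [w] has to exceed [u]. Sparsity
    ensures that a single scale matters among the integers with logarithm between [(ln x) / 2] and
    [ln x], so the densities at different scales do not add up. *)

Lemma sum_dvd (V : nmodType) (F : nat -> V) (d N : nat) : (0 < d)%N ->
  \sum_(1 <= m < N.+1 | (d %| m)%N) F m = \sum_(1 <= l < (N %/ d).+1) F (d * l)%N.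
Proof.
move=> d0; rewrite -big_filter -(big_map (muln d) predT F); apply: perm_big.
apply: uniq_perm.
- by rewrite filter_uniq// iota_uniq.
- by rewrite map_inj_uniq ?iota_uniq// => x y /eqP; rewrite eqn_pmul2l// => /eqP.
move=> m; rewrite mem_filter mem_index_iota; apply/idP/mapP.
  case/andP=> /dvdnP[l ->]; rewrite muln_gt0 => /andP[/andP[l0 _] lN].
  exists l; last by rewrite mulnC.
  by rewrite mem_index_iota l0 ltnS leq_divRL.
case=> l; rewrite mem_index_iota => /andP[l0]; rewrite ltnS leq_divRL// => lN ->.
by rewrite dvdn_mulr// muln_gt0 d0 l0/= ltnS mulnC.
Qed.

Lemma bin_le_exp2 n m : ('C(n, m) <= 2 ^ n)%N.
Proof.
elim: n m => [|n IH] [|m]; rewrite ?bin0 ?expn_gt0//.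
by rewrite binS expnS mul2n -addnn leq_add.
Qed.

Section vonMangoldt.
Context {R : realType}.

Lemma ln_logn (N m : nat) : (0 < m <= N)%N ->
  ln (m%:R : R) = \sum_(1 <= p < N.+1 | prime p) (logn p m)%:R * ln p%:R.
Proof.
elim/ltn_ind: m => m IH /andP[m0 mN].
have [m1|m1] := leqP m 1.
  have -> : m = 1%N by lia.
  by rewrite ln1 big1// => p _; rewrite logn1 mul0r.
set q := pdiv m; have qpr : prime q by exact: pdiv_prime.
have [q0 q1] := (prime_gt0 qpr, prime_gt1 qpr).
have qm : (q <= m)%N by apply: dvdn_leq => //; exact: pdiv_dvd.
have mE : m = (q * (m %/ q))%N by rewrite mulnC divnK// pdiv_dvd.
have mq0 : (0 < m %/ q)%N by rewrite divn_gt0.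
have mqm : (m %/ q < m)%N by exact: ltn_Pdiv.
rewrite [in LHS]mE natrM lnM ?posrE ?ltr0n// (IH (m %/ q)%N) ?mq0 ?(ltnW (leq_trans mqm _))//.
rewrite [in RHS]mE.
under [RHS]eq_bigr do rewrite lognM// natrD mulrDl.
rewrite [RHS]big_split/=; congr (_ + _).
rewrite big_mkcond (bigD1_seq q) ?iota_uniq//=; last first.
  by rewrite mem_index_iota q0 ltnS (leq_trans qm).
rewrite qpr logn_prime// eqxx mul1r big1 ?addr0// => p pq; case: ifP => // ppr.
by rewrite logn_prime// (negbTE pq) mul0r.
Qed.

(* Equal to the von Mangoldt function at [d] only for [d <= N]. *)
Definition vonMangoldt (N d : nat) : R :=
  \sum_(1 <= p < N.+1 | prime p) \sum_(1 <= j < N.+1 | (p ^ j == d)%N) ln p%:R.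

Lemma vonMangoldt_ge0 N d : 0 <= vonMangoldt N d.
Proof.
apply: sumr_ge0 => p ppr; apply: sumr_ge0 => j _.
by apply: ln_ge0; rewrite ler1n prime_gt0.
Qed.

Lemma vonMangoldt_prime N p : (p <= N)%N -> prime p -> ln p%:R <= vonMangoldt N p.
Proof.
move=> pN ppr; have p0 := prime_gt0 ppr.
have ln0 q : prime q -> 0 <= ln (q%:R : R).
  by move=> qpr; apply: ln_ge0; rewrite ler1n prime_gt0.
rewrite /vonMangoldt big_mkcond (bigD1_seq p) ?iota_uniq//=; last first.
  by rewrite mem_index_iota p0 ltnS.
rewrite ppr big_mkcond (bigD1_seq 1%N) ?iota_uniq//= ?expn1 ?eqxx//; last first.
  by rewrite mem_index_iota; lia.
rewrite -addrA lerDl addr_ge0//.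
  by apply: sumr_ge0 => j _; case: ifP => // _; exact: ln0.
apply: sumr_ge0 => q _; case: ifP => // qpr.
by apply: sumr_ge0 => j _; exact: ln0.
Qed.

Lemma sum_vonMangoldt_dvd (N m : nat) : (0 < m <= N)%N ->
  \sum_(1 <= d < N.+1 | (d %| m)%N) vonMangoldt N d = ln m%:R.
Proof.
move=> /andP[m0 mN]; rewrite (@ln_logn N)// ?m0//.
rewrite exchange_big/=; apply: eq_bigr => p ppr.
under eq_bigr do rewrite big_mkcond/=.
rewrite exchange_big/=.
have -> : logn p m = (\sum_(1 <= j < N.+1) (p ^ j %| m))%N.
  rewrite logn_count_dvd// [RHS](big_cat_nat _ (n := m))//=; last exact: leqW.
  rewrite [X in (_ + X)%N]big_nat_cond [X in (_ + X)%N]big1 ?addn0// => j /andP[/andP[mj _] _].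
  apply/eqP; rewrite eqb0; apply/negP => /dvdn_leq -/(_ m0).
  by rewrite leqNgt (leq_ltn_trans mj)// ltn_expl// prime_gt1.
rewrite natr_sum mulr_suml; apply: eq_bigr => j _.
rewrite -big_mkcondr/=; have [pjm|pjm] := boolP (p ^ j %| m)%N; last first.
  rewrite mul0r big1// => d /andP[dm /eqP pjd].
  by rewrite pjd dm in pjm.
rewrite mul1r -big_filter.
rewrite (_ : [seq _ <- _ | _] = [:: (p ^ j)%N]) ?big_seq1//.
apply: perm_small_eq => //; apply: uniq_perm => //.
  by rewrite filter_uniq ?iota_uniq.
move=> d; rewrite mem_filter mem_index_iota inE.
have [->|_] := eqVneq d (p ^ j)%N; last by rewrite andbF.
rewrite pjm/= expn_gt0 prime_gt0//= ltnS (leq_trans _ mN)//.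
exact: dvdn_leq.
Qed.

Lemma ln_fact (N n : nat) : (n <= N)%N ->
  ln (n`!%:R : R) = \sum_(1 <= d < N.+1) vonMangoldt N d * (n %/ d)%:R.
Proof.
move=> nN; have -> : ln (n`!%:R : R) = \sum_(1 <= m < n.+1) ln m%:R.
  elim: n {nN} => [|n IH]; first by rewrite fact0 ln1 big_geq.
  by rewrite factS mulnC natrM lnM ?posrE ?ltr0n ?fact_gt0// IH [RHS]big_nat_recr.
rewrite big_nat_cond.
under eq_bigr => m /andP[/andP[m0 mn] _].
  rewrite -(@sum_vonMangoldt_dvd N) ?m0 ?(leq_trans _ nN)// big_mkcond; over.
rewrite -big_nat_cond exchange_big/= [LHS]big_nat_cond [RHS]big_nat_cond.
apply: eq_bigr => d /andP[/andP[d0 dN] _].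
by rewrite -big_mkcond/= sum_dvd// sumr_const_nat subn1 mulr_natr.
Qed.

(** A binomial coefficient is at most [2 ^ n], which accounts for [n * ln 2 <= n]. The factor [m.+1]
    covers odd [n]; its logarithm is absorbed by the second [n]. *)
Lemma ln_fact_half (n : nat) :
  ln (n`!%:R : R) - 2 * ln ((n./2)`!%:R : R) <= 2 * n%:R.
Proof.
set m := n./2.
have fact0 k : 0 < (k`!%:R : R) by rewrite ltr0n fact_gt0.
have mn : (m <= n)%N by rewrite /m; lia.
have : (n`! <= 2 ^ n * (m`! * (m`! * m.+1)))%N.
  rewrite -(bin_fact mn) leq_mul ?bin_le_exp2// leq_mul2l; apply/orP; right.
  have : (n - m == m)%N || (n - m == m.+1)%N by rewrite /m; lia.
  by case/orP=> /eqP ->; [rewrite leq_pmulr|rewrite factS mulnC].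
rewrite -(ler_nat R) !natrM natrX -ler_ln ?posrE ?fact0//.
rewrite !lnM ?posrE ?mulr_gt0 ?fact0 ?exprn_gt0 ?ltr0n// lnXn//.
have ln2 : ln (2 : R) <= 1.
  by have := @le_ln1Dx R 1; rewrite (_ : 1 + 1 = 2)//; apply; lra.
have lnm : ln (m.+1%:R : R) <= n%:R.
  have := @le_ln1Dx R m%:R; rewrite -natr1 addrC => h.
  apply: le_trans (h _) _; first by have := ler0n R m; lra.
  by rewrite ler_nat.
have : ln 2 *+ n <= n%:R :> R by rewrite -[X in X <= _]mulr_natl ler_piMr.
lra.
Qed.

(** Chebyshev's halving. In [ln n! - 2 ln (n./2)!] every [vonMangoldt N d] has a nonnegative
    coefficient, which is at least 1 for [n/2 < d <= n]. A halving costs [2 n], and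
    [2 n + n + n / 2 + ... <= 4 n]. *)
Lemma sum_vonMangoldt_le (N n : nat) : (n <= N)%N ->
  \sum_(1 <= d < n.+1) vonMangoldt N d <= 4 * n%:R.
Proof.
elim/ltn_ind: n => n IH nN.
have [->|n0] := posnP n; first by rewrite big_geq// mulr0.
have mn : (n./2 < n)%N by lia.
rewrite (big_cat_nat _ (n := n./2.+1))//=; last exact: ltnW.
have {}IH := IH _ mn (leq_trans (ltnW mn) nN).
have : \sum_(n./2.+1 <= d < n.+1) vonMangoldt N d <= 2 * n%:R.
  apply: le_trans (ln_fact_half n).
  rewrite (@ln_fact N n)// (@ln_fact N n./2) ?(leq_trans (ltnW mn))//.
  rewrite mulr_sumr -sumrB.
  have term d : vonMangoldt N d * (n %/ d)%:R - 2 * (vonMangoldt N d * (n./2 %/ d)%:R) =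
      vonMangoldt N d * (n %/ d - 2 * (n./2 %/ d))%:R.
    rewrite natrB ?natrM; first by ring.
    have [->|d0] := posnP d; first by rewrite !divn0.
    rewrite leq_divRL//; apply: leq_trans (_ : n./2 * 2 <= n)%N; last by lia.
    by rewrite -mulnA mulnC leq_mul2r leq_trunc_div orbT.
  under [X in _ <= X]eq_bigr do rewrite term.
  rewrite [X in _ <= X](big_cat_nat _ (n := n./2.+1))//=; last by lia.
  rewrite [X in _ <= _ + X](big_cat_nat _ (n := n.+1))//=; last by lia.
  have ge0 i j : 0 <= \sum_(i <= d < j) vonMangoldt N d * (n %/ d - 2 * (n./2 %/ d))%:R.
    by apply: sumr_ge0 => d _; rewrite mulr_ge0 ?vonMangoldt_ge0.
  apply: ler_wpDl => //; apply: ler_wpDr => //.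
  rewrite [X in X <= _]big_nat_cond [X in _ <= X]big_nat_cond.
  apply: ler_sum => d /andP[/andP[d1 d2] _].
  rewrite ler_peMr ?vonMangoldt_ge0// ler1n (@divn_small n./2)// muln0 subn0.
  by rewrite divn_gt0//; lia.
have : 2 * (n./2%:R : R) <= n%:R by rewrite -natrM ler_nat; lia.
lra.
Qed.

(** Since [n / d <= n %/ d + 1], [n] times the sum is at most [ln n!] plus the Chebyshev sum, that
    is [n ln n + 4 n]. *)
Lemma sum_ln_prime_div_le (n : nat) : (0 < n)%N ->
  \sum_(1 <= p < n.+1 | prime p) ln (p%:R : R) / p%:R <= ln n%:R + 4.
Proof.
move=> n0; have n0R : 0 < (n%:R : R) by rewrite ltr0n.
apply: (@le_trans _ _ (\sum_(1 <= d < n.+1) vonMangoldt n d / d%:R)).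
  rewrite big_mkcond/= [X in X <= _]big_nat_cond [X in _ <= X]big_nat_cond.
  apply: ler_sum => p /andP[/andP[p0 pn] _]; case: ifPn => ppr.
    by rewrite ler_pM2r ?invr_gt0 ?ltr0n// vonMangoldt_prime.
  by rewrite divr_ge0 ?vonMangoldt_ge0.
rewrite -(ler_pM2l n0R).
apply: (@le_trans _ _ (ln n`!%:R + \sum_(1 <= d < n.+1) vonMangoldt n d)).
  rewrite (@ln_fact n n)// mulr_sumr -big_split/=.
  rewrite [X in X <= _]big_nat_cond [X in _ <= X]big_nat_cond.
  apply: ler_sum => d /andP[/andP[d0 dn] _].
  rewrite mulrCA -[X in _ <= _ + X]mulr1 -mulrDr ler_wpM2l ?vonMangoldt_ge0//.
  rewrite ler_pdivrMr ?ltr0n// natr1 -natrM ler_nat.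
  by rewrite ltnW// ltn_ceil.
have lnf : ln (n`!%:R : R) <= n%:R * ln n%:R.
  rewrite mulr_natl -lnXn// ler_ln ?posrE ?ltr0n ?fact_gt0 ?exprn_gt0//.
  rewrite -natrX ler_nat; elim: n {n0 n0R} => // n IH.
  rewrite factS expnS leq_mul2l /=; apply: leq_trans IH _.
  by case: n => // n; rewrite leq_exp2r.
by have := @sum_vonMangoldt_le n n (leqnn n); lra.
Qed.

(* Hall--Tenenbaum: expand [ln m] with the von Mangoldt function and use Chebyshev's bound. *)
Lemma submult_mean_le (f : nat -> R) (N : nat) :
  (forall m, 0 <= f m) ->
  (forall d l, (0 < d)%N -> (0 < l)%N -> f (d * l)%N <= f l) ->
  ln N%:R * \sum_(1 <= m < N.+1) f m <=
  5 * N%:R * \sum_(1 <= m < N.+1) f m / m%:R.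
Proof.
move=> f0 fM.
(* Write [m = d l] and bound [f (d l)] by [f l]; for fixed [l] the von Mangoldt sum over
   [d <= N / l] is at most [4 N / l]. *)
have h1 : \sum_(1 <= m < N.+1) f m * ln m%:R <= 4 * N%:R * \sum_(1 <= m < N.+1) f m / m%:R.
  rewrite big_nat_cond.
  under eq_bigr => m /andP[/andP[m0 mn] _].
    rewrite -(@sum_vonMangoldt_dvd N) ?m0// big_mkcond mulr_sumr; over.
  rewrite -big_nat_cond exchange_big/=.
  apply: (@le_trans _ _ (\sum_(1 <= d < N.+1) \sum_(1 <= l < N.+1 | (d * l <= N)%N)
     f l * vonMangoldt N d)).
    rewrite [X in X <= _]big_nat_cond [X in _ <= X]big_nat_cond.
    apply: ler_sum => d /andP[/andP[d0 dn] _].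
    under eq_bigr => m _ do rewrite (fun_if (fun x => f m * x)) mulr0.
    rewrite -big_mkcond/= sum_dvd//.
    rewrite [X in _ <= X](big_cat_nat _ (n := (N %/ d).+1))//=; last first.
      by rewrite ltnS leq_div.
    apply: ler_wpDr.
      by apply: sumr_ge0 => l _; rewrite mulr_ge0 ?vonMangoldt_ge0.
    rewrite [X in _ <= X]big_mkcond/= [X in X <= _]big_nat_cond [X in _ <= X]big_nat_cond.
    apply: ler_sum => l /andP[/andP[l0]]; rewrite ltnS leq_divRL// mulnC => ln _.
    by rewrite ln ler_wpM2r ?vonMangoldt_ge0// fM.
  under [X in X <= _]eq_bigr do rewrite big_mkcond/=.
  rewrite exchange_big/= mulr_sumr.
  rewrite [X in X <= _]big_nat_cond [X in _ <= X]big_nat_cond.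
  apply: ler_sum => l /andP[/andP[l0 lN] _].
  rewrite -big_mkcond/=.
  have lN' : (N %/ l <= N)%N by exact: leq_div.
  rewrite (big_cat_nat _ (n := (N %/ l).+1))//=.
  rewrite [X in _ + X]big_nat_cond [X in _ + X]big1 ?addr0; last first.
    move=> d /andP[/andP[dl _]]; rewrite leqNgt mulnC => /negP[].
    by move: dl; rewrite ltn_divLR// mulnC.
  rewrite big_mkcond/=.
  apply: (@le_trans _ _ (f l * \sum_(1 <= d < (N %/ l).+1) vonMangoldt N d)).
    rewrite mulr_sumr; apply: ler_sum => d _; case: ifP => // _.
    by rewrite mulr_ge0 ?vonMangoldt_ge0.
  rewrite mulrCA -mulrA ler_wpM2l// mulrA.
  apply: le_trans (sum_vonMangoldt_le lN') _.
  rewrite -mulrA ler_wpM2l// ler_pdivlMr ?ltr0n// -natrM ler_nat.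
  exact: leq_trunc_div.
rewrite [X in X <= _]mulr_sumr.
(* The deficit [ln N - ln m = ln (N / m)] is below [N / m], which raises the constant from 4 to
   5. *)
have h2 : \sum_(1 <= m < N.+1) f m * (ln N%:R - ln m%:R) <= N%:R * \sum_(1 <= m < N.+1) f m / m%:R.
  rewrite mulr_sumr [X in X <= _]big_nat_cond [X in _ <= X]big_nat_cond.
  apply: ler_sum => m /andP[/andP[m0 mN] _].
  rewrite mulrCA ler_wpM2l//.
  have N0 : (0 < N)%N by lia.
  by rewrite -ln_div ?posrE ?ltr0n// ltW// ln_sublinear// divr_gt0 ?ltr0n.
have -> : \sum_(1 <= m < N.+1) ln N%:R * f m = \sum_(1 <= m < N.+1) f m * ln m%:R +
   \sum_(1 <= m < N.+1) f m * (ln N%:R - ln m%:R).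
  by rewrite -big_split/=; apply: eq_bigr => m _; ring.
lra.
Qed.

End vonMangoldt.

(** * Sums of nonnegative series *)

Section dsum.
Context {R : realType}.
Implicit Types (g h u : nat -> R) (M c : R) (N d : nat).

Definition summable g := (forall n, 0 <= g n) /\
  exists M, forall N, \sum_(0 <= n < N) g n <= M.

Definition dsum g : R := limn (series g).

Lemma summable_cvg g : summable g -> series g @ \oo --> dsum g.
Proof.
move=> [g0 [M gM]]; apply: nondecreasing_is_cvgn.
  by apply: nondecreasing_series => n _ _; exact: g0.
by exists M => _ [N _ <-]; exact: gM.
Qed.

Lemma le_dsum g N : summable g -> \sum_(0 <= n < N) g n <= dsum g.
Proof.
move=> sg; apply: (@nondecreasing_cvgn_le R (series g)); last exact: summable_cvg sg.
by apply: nondecreasing_series => n _ _; exact: (proj1 sg).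
Qed.

Lemma dsum_le g M : summable g -> (forall N, \sum_(0 <= n < N) g n <= M) -> dsum g <= M.
Proof.
move=> sg gM; apply: limr_le; first exact: summable_cvg sg.
by near=> N; exact: gM.
Unshelve. all: by end_near. Qed.

Lemma summable_bound g M : (forall n, 0 <= g n) ->
  (forall N, \sum_(0 <= n < N) g n <= M) -> summable g.
Proof. by move=> g0 gM; split=> //; exists M. Qed.

Lemma dsum_ge0 g : summable g -> 0 <= dsum g.
Proof. by move=> sg; have := le_dsum 0 sg; rewrite big_geq. Qed.

Lemma summable_le g h : (forall n, 0 <= g n <= h n) -> summable h -> summable g.
Proof.
move=> gh sh; apply: (@summable_bound _ (dsum h)) => [n|N].
  by case/andP: (gh n).
apply: le_trans (le_dsum N sh); apply: ler_sum => n _.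
by case/andP: (gh n).
Qed.

Lemma ler_dsum g h : (forall n, 0 <= g n <= h n) -> summable h -> dsum g <= dsum h.
Proof.
move=> gh sh; apply: dsum_le => [|N]; first exact: summable_le gh sh.
apply: le_trans (le_dsum N sh); apply: ler_sum => n _.
by case/andP: (gh n).
Qed.

Lemma eq_dsum g h : g =1 h -> dsum g = dsum h.
Proof. by move=> /funext ->. Qed.

Lemma summableD g h : summable g -> summable h -> summable (fun n => g n + h n).
Proof.
move=> sg sh; apply: (@summable_bound _ (dsum g + dsum h)) => [n|N].
  by rewrite addr_ge0 ?(proj1 sg) ?(proj1 sh).
by rewrite big_split lerD ?le_dsum.
Qed.

Lemma dsumD g h : summable g -> summable h -> dsum (fun n => g n + h n) = dsum g + dsum h.
Proof.
move=> sg sh; apply: cvg_lim => //.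
rewrite (_ : series _ = series g \+ series h).
  by apply: cvgD; exact: summable_cvg.
by apply/funext => N; rewrite /series/= big_split.
Qed.

Lemma summableZ c g : 0 <= c -> summable g -> summable (fun n => c * g n).
Proof.
move=> c0 sg; apply: (@summable_bound _ (c * dsum g)) => [n|N].
  by rewrite mulr_ge0 ?(proj1 sg)//.
by rewrite -mulr_sumr ler_wpM2l ?le_dsum.
Qed.

Lemma dsumZ c g : summable g -> dsum (fun n => c * g n) = c * dsum g.
Proof.
move=> sg; apply: cvg_lim => //.
rewrite (_ : series _ = fun N => c * series g N).
  by apply: cvgM; [exact: cvg_cst|exact: summable_cvg].
by apply/funext => N; rewrite /series/= mulr_sumr.
Qed.

Lemma dsum_sum (I : eqType) (s : seq I) (g : I -> nat -> R) :
  (forall i, summable (g i)) ->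
  summable (fun n => \sum_(i <- s) g i n) /\
  dsum (fun n => \sum_(i <- s) g i n) = \sum_(i <- s) dsum (g i).
Proof.
move=> sg; elim: s => [|i s [IH1 IH2]].
  have s0 : summable (fun n => \sum_(i <- [::]) g i n).
    apply: (@summable_bound _ 0) => [n|N]; first by rewrite big_nil.
    by rewrite big1// => n _; rewrite big_nil.
  split=> //; rewrite big_nil; apply/eqP; rewrite eq_le dsum_ge0// andbT.
  by apply: dsum_le => // N; rewrite big1// => n _; rewrite big_nil.
have E : (fun n => \sum_(j <- i :: s) g j n) = fun n => g i n + \sum_(j <- s) g j n.
  by apply/funext => n; rewrite big_cons.
by rewrite E; split; [exact: summableD|rewrite dsumD// IH2 big_cons].
Qed.

Lemma sum_nat1 g N : g 0%N = 0 -> \sum_(0 <= n < N.+1) g n = \sum_(1 <= n < N.+1) g n.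
Proof. by move=> g0; rewrite big_ltn// g0 add0r. Qed.

Lemma dsum_dvd g d : summable g -> g 0%N = 0 -> (0 < d)%N ->
  dsum (fun n => g (d * n)%N) = dsum (fun n => (d %| n)%N%:R * g n).
Proof.
move=> sg g0 d0.
have sg2 : summable (fun n => (d %| n)%N%:R * g n).
  apply: (summable_le _ sg) => n; case: (d %| n)%N; rewrite ?mul1r ?mul0r ?lexx ?(proj1 sg)//.
have E N : \sum_(1 <= n < N.+1) (d %| n)%N%:R * g n = \sum_(1 <= l < (N %/ d).+1) g (d * l)%N.
  rewrite -(@sum_dvd _ g)// [RHS]big_mkcond/=; apply: eq_bigr => n _.
  by case: ifP; rewrite ?mul1r ?mul0r.
have sg1 : summable (fun n => g (d * n)%N).
  apply: (@summable_bound _ (dsum (fun n => (d %| n)%N%:R * g n))) => [n|[|N]].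
  - exact: (proj1 sg).
  - by rewrite big_geq// dsum_ge0.
  - rewrite sum_nat1 ?muln0// -{1}(mulnK N d0) -E -sum_nat1 ?g0 ?mulr0//.
    exact: le_dsum.
apply/eqP; rewrite eq_le; apply/andP; split; apply: dsum_le => // -[|N].
- by rewrite big_geq// dsum_ge0.
- rewrite sum_nat1 ?muln0// -{1}(mulnK N d0) -E -sum_nat1 ?g0 ?mulr0//.
  exact: le_dsum.
- by rewrite big_geq// dsum_ge0.
- rewrite sum_nat1 ?g0 ?mulr0// E -(@sum_nat1 (fun n => g (d * n)%N)) ?muln0//.
  exact: le_dsum.
Qed.

(** By [dsum_dvd] the multiples of [d] carry the proportion [c] of the sum. For [d] prime this
    splits off one Euler factor. *)
Lemma dsum_coprime g d c : summable g -> g 0%N = 0 -> (0 < d)%N ->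
  (forall m, g (d * m)%N = c * g m) ->
  dsum (fun n => (~~ (d %| n)%N)%:R * g n) = (1 - c) * dsum g.
Proof.
move=> sg g0 d0 gc.
have s1 (b : nat -> bool) : summable (fun n => (b n)%:R * g n).
  by apply: (summable_le _ sg) => n; case: (b n); rewrite ?mul1r ?mul0r ?lexx ?(proj1 sg)//.
have := dsumD (s1 (fun n => ~~ (d %| n)%N)) (s1 (dvdn d)).
rewrite -dsum_dvd// (eq_dsum gc) dsumZ// (_ : dsum (fun n => _ + _) = dsum g).
  by rewrite mulrBl mul1r => {1}->; rewrite addrK.
by apply: eq_dsum => n; rewrite -mulrDl; case: (d %| n)%N; rewrite ?addr0 ?add0r mul1r.
Qed.

End dsum.

(** * Dirichlet series and Euler products *)

Section dirichlet.
Context {R : realType}.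
Implicit Types (delta : R) (n m p N : nat).

Definition dterm delta n : R := n%:R `^ (- (1 + delta)).

Lemma dterm_ge0 delta n : 0 <= dterm delta n.
Proof. exact: powR_ge0. Qed.

Lemma dterm0 delta : 0 < delta -> dterm delta 0 = 0.
Proof. by move=> d0; rewrite /dterm powR0// oppr_eq0 gt_eqF//; lra. Qed.

Lemma dterm1 delta : dterm delta 1 = 1.
Proof. by rewrite /dterm powR1. Qed.

Lemma dtermM delta m n : dterm delta (m * n) = dterm delta m * dterm delta n.
Proof. by rewrite /dterm natrM powRM. Qed.

Lemma dtermE delta n : (0 < n)%N -> dterm delta n = n%:R^-1 * expR (- delta * ln n%:R).
Proof.
move=> n0; have n0R : 0 < (n%:R : R) by rewrite ltr0n.
rewrite /dterm opprD powRD; last by apply/implyP => _; rewrite gt_eqF.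
by rewrite powR_inv1 ?ltW// /powR gt_eqF.
Qed.

Lemma dterm_le_inv delta n : 0 <= delta -> (0 < n)%N -> dterm delta n <= n%:R^-1.
Proof.
move=> d0 n0; rewrite dtermE// ler_piMr ?invr_ge0// expR_le1 mulNr oppr_le0.
by rewrite mulr_ge0// ln_ge0// ler1n.
Qed.

Lemma dterm_lt1 delta n : 0 <= delta -> (1 < n)%N -> dterm delta n < 1.
Proof.
move=> d0 n1; apply: le_lt_trans (dterm_le_inv d0 _) _; first exact: ltnW.
by rewrite invf_lt1 ?ltr1n ?ltr0n// ltnW.
Qed.

Lemma dterm_le_half delta n : 0 <= delta -> (1 < n)%N -> dterm delta n <= 2^-1.
Proof.
move=> d0 n1; apply: le_trans (dterm_le_inv d0 (ltnW n1)) _.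
by rewrite lef_pV2 ?posrE ?ltr0n ?ler_nat// ltnW.
Qed.

Lemma ler_dterm (d1 d2 : R) n : d1 <= d2 -> (0 < n)%N -> dterm d2 n <= dterm d1 n.
Proof.
move=> d12 n0; rewrite !dtermE// ler_wpM2l ?invr_ge0// ler_expR !mulNr lerN2.
by rewrite ler_wpM2r// ln_ge0 ?ler1n.
Qed.

(** The middle term is [delta] times the integral of [x^-(1 + delta)] over [[n, n + 1]]. Integration
    is replaced by [1 / (n + 1) <= ln (n + 1) - ln n <= 1 / n] and [1 + x <= exp x]. *)
Lemma powRN_telescope delta n : 0 <= delta -> (0 < n)%N ->
  delta * dterm delta n.+1 <= expR (- delta * ln n%:R) - expR (- delta * ln n.+1%:R)
  <= delta * dterm delta n.
Proof.
move=> d0 n0; have n0R : 0 < (n%:R : R) by rewrite ltr0n.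
have n1R : 0 < (n.+1%:R : R) by rewrite ltr0n.
rewrite !dtermE//.
set x := ln (n%:R : R); set y := ln (n.+1%:R : R).
have yx1 : y - x <= n%:R^-1.
  rewrite /y /x -ln_div ?posrE// -natr1 mulrDl divff ?gt_eqF// mul1r.
  by apply: le_ln1Dx; have := invr_gt0 (n%:R : R); rewrite n0R; lra.
have yx2 : n.+1%:R^-1 <= y - x.
  have -> : y - x = - ln (1 - n.+1%:R^-1).
    have -> : 1 - n.+1%:R^-1 = n%:R / n.+1%:R :> R.
      by rewrite -[in RHS](addrK 1 n%:R) natr1 mulrBl divff ?mul1r ?gt_eqF.
    by rewrite ln_div ?posrE// opprB.
  by rewrite lerNr; apply: le_ln1Dx; rewrite ltrN2 invf_lt1// ltr1n.
move: yx1 yx2; move: (n.+1%:R^-1) (n%:R^-1) x y => i j x y yx1 yx2.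
have ex := expR_gt0 (- delta * x); have ey := expR_gt0 (- delta * y).
have e1 : expR (- delta * x) = expR (- delta * y) * expR (delta * (y - x)).
  by rewrite -expRD; congr expR; ring.
have e2 : expR (- delta * y) = expR (- delta * x) * expR (- delta * (y - x)).
  by rewrite -expRD; congr expR; ring.
apply/andP; split.
  have h : delta * i <= expR (delta * (y - x)) - 1.
    have := expR_ge1Dx (delta * (y - x)).
    have := ler_wpM2l d0 yx2; lra.
  have := ler_wpM2l (ltW ey) h; rewrite e1; lra.
have h : 1 - expR (- delta * (y - x)) <= delta * j.
  have := expR_ge1Dx (- delta * (y - x)).
  have := ler_wpM2l d0 yx1; lra.
have := ler_wpM2l (ltW ex) h; rewrite [X in _ - X <= _]e2; lra.
Qed.

Lemma sum_dterm_le delta N : 0 < delta -> \sum_(0 <= n < N) dterm delta n <= 1 + delta^-1.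
Proof.
move=> d0.
have h : \sum_(0 <= n < N.+2) dterm delta n <= 1 + delta^-1 * (1 - expR (- delta * ln N.+1%:R)).
  elim: N => [|N IH].
    by rewrite !big_nat_recr//= big_geq// dterm0// dterm1 ln1 mulr0 expR0; lra.
  rewrite big_nat_recr//=; apply: le_trans (lerD IH (lexx _)) _.
  have /andP[h _] := powRN_telescope (ltW d0) (ltn0Sn N).
  have : dterm delta N.+2 <= delta^-1 * (expR (- delta * ln N.+1%:R) - expR (- delta * ln N.+2%:R)).
    by rewrite ler_pdivlMl.
  lra.
have : \sum_(0 <= n < N) dterm delta n <= \sum_(0 <= n < N.+2) dterm delta n.
  by rewrite !big_nat_recr//= -addrA lerDl addr_ge0 ?dterm_ge0.
have : 0 <= delta^-1 * expR (- delta * ln N.+1%:R) by rewrite mulr_ge0 ?expR_ge0// invr_ge0 ltW.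
lra.
Qed.

Lemma summable_dterm delta : 0 < delta -> summable (dterm delta).
Proof.
move=> d0; apply: (@summable_bound _ _ (1 + delta^-1)) => [n|N].
  exact: dterm_ge0.
exact: sum_dterm_le.
Qed.

(** Telescoping gives [(1 - exp(- delta ln (N + 1))) / delta], and the hypothesis makes the
    exponential at most [1 / 2]. *)
Lemma sum_dterm_ge delta N : 0 < delta -> 1 <= delta * ln N.+1%:R ->
  (2 * delta)^-1 <= \sum_(1 <= n < N.+1) dterm delta n.
Proof.
move=> d0 dN.
have h M : delta^-1 * (1 - expR (- delta * ln M.+1%:R)) <= \sum_(1 <= n < M.+1) dterm delta n.
  elim: M => [|M IH].
    by rewrite big_geq// ln1 mulr0 expR0 subrr mulr0.
  rewrite [X in _ <= X]big_nat_recr//=; apply: le_trans (lerD IH (lexx _)).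
  have /andP[_ h] := powRN_telescope (ltW d0) (ltn0Sn M).
  have : delta^-1 * (expR (- delta * ln M.+1%:R) - expR (- delta * ln M.+2%:R)) <= dterm delta M.+1.
    by rewrite ler_pdivrMl.
  lra.
apply: le_trans (h N); rewrite invfM mulrC ler_pM2l ?invr_gt0//.
have : expR (- delta * ln N.+1%:R) <= 2^-1.
  rewrite mulNr expRN lef_pV2 ?posrE ?expR_gt0//.
  by have := expR_ge1Dx (delta * ln (N.+1%:R : R)); lra.
lra.
Qed.

(** Multiplicity is counted so that [omega] is additive on all products of positive integers, not
    only on coprime ones. *)
Definition omega (Q : seq nat) n := (\sum_(p <- Q) logn p n)%N.

Lemma omegaM Q m n : (0 < m)%N -> (0 < n)%N -> omega Q (m * n) = (omega Q m + omega Q n)%N.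
Proof. by move=> m0 n0; rewrite -big_split; apply: eq_bigr => p _; exact: lognM. Qed.

Lemma omega_prime Q p : prime p -> uniq Q -> omega Q p = (p \in Q).
Proof.
move=> ppr uQ; rewrite -count_uniq_mem// -sum1_count [RHS]big_mkcond.
by apply: eq_bigr => q _; rewrite logn_prime//=; case: eqP.
Qed.

Lemma omega_cat Q P n : omega (Q ++ P) n = (omega Q n + omega P n)%N.
Proof. by rewrite /omega big_cat. Qed.

Lemma omega_eq0 Q n p : omega Q n = 0%N -> p \in Q -> prime p -> (0 < n)%N -> ~~ (p %| n)%N.
Proof.
move=> /eqP; rewrite sum_nat_seq_eq0 => /allP h pQ ppr n0.
by have := h _ pQ; rewrite lognE ppr n0/=; case: (p %| n)%N.
Qed.

Lemma omega_cons Q p n : omega (p :: Q) n = (logn p n + omega Q n)%N.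
Proof. by rewrite /omega big_cons. Qed.

Section euler.
Variable delta : R.
Hypothesis d0 : 0 < delta.
Let t := dterm delta.

Let st : summable t. Proof. exact: summable_dterm. Qed.

Lemma summable_dtermM (f : nat -> R) : (forall n, 0 <= f n <= 1) ->
  summable (fun n => f n * t n).
Proof.
move=> f01; apply: (summable_le _ st) => n; have /andP[f0 f1] := f01 n.
by rewrite mulr_ge0 ?dterm_ge0//= ler_piMl ?dterm_ge0.
Qed.

(** One prime at a time: the series for [p :: Q] and for [Q] agree off the multiples of [p], whose
    removal multiplies them by [1 - B * t p] and [1 - t p] respectively. For [B = 0] the convention
    [0 ^+ 0 = 1] makes the left series run over the integers free of the primes of [Q]. *)
Lemma dsum_omega (B : R) (Q : seq nat) : 0 <= B <= 1 -> all prime Q -> uniq Q ->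
  dsum (fun n => B ^+ omega Q n * t n) * \prod_(p <- Q) (1 - B * t p) =
  dsum t * \prod_(p <- Q) (1 - t p).
Proof.
move=> /andP[B0 B1].
have sB Q' : summable (fun n => B ^+ omega Q' n * t n).
  by apply: summable_dtermM => n; rewrite exprn_ge0//= exprn_ile1.
elim: Q => [|p Q IH].
  move=> _ _; rewrite !big_nil !mulr1; apply: eq_dsum => n.
  by rewrite /omega big_nil mul1r.
move=> /= /andP[ppr prQ] /andP[pQ uQ]; rewrite !big_cons.
have p0 := prime_gt0 ppr; have prE : omega Q p = 0%N by rewrite omega_prime// (negbTE pQ).
have z0 Q' : B ^+ omega Q' 0 * t 0 = 0 by rewrite /t dterm0// mulr0.
have E : (1 - B * t p) * dsum (fun n => B ^+ omega (p :: Q) n * t n) =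
   (1 - t p) * dsum (fun n => B ^+ omega Q n * t n).
  rewrite -(dsum_coprime (sB (p :: Q)) (z0 (p :: Q)) p0); last first.
    move=> [|m]; first by rewrite muln0 z0 mulr0.
    rewrite omegaM// omega_cons logn_prime// eqxx prE addn0 exprD expr1 /t dtermM.
    by ring.
  rewrite -(dsum_coprime (sB Q) (z0 Q) p0); last first.
    move=> [|m]; first by rewrite muln0 z0 mulr0.
    by rewrite omegaM// prE add0n /t dtermM mulrCA.
  apply: eq_dsum => n; rewrite omega_cons.
  have [_|pn] := boolP (p %| n)%N; first by rewrite !mul0r.
  by rewrite lognE (negbTE pn) !andbF.
rewrite mulrA [_ * (1 - B * t p)]mulrC E mulrAC -!mulrA -[RHS]mulrCA; congr (_ * _).
by rewrite mulrC IH.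
Qed.

Definition smooth (Q : seq nat) n := all (fun p => p \in Q) (primes n).

(** Removing the multiples of [p] from the [p :: Q]-smooth integers leaves the [Q]-smooth ones; for
    empty [Q] only [n = 1] contributes, since [t 0 = 0]. *)
Lemma dsum_smooth (Q : seq nat) : all prime Q -> uniq Q ->
  dsum (fun n => (smooth Q n)%:R * t n) * \prod_(p <- Q) (1 - t p) = 1.
Proof.
have sS Q' : summable (fun n => (smooth Q' n)%:R * t n).
  by apply: summable_dtermM => n; case: (smooth Q' n); rewrite ?ler01 ?lexx.
have z0 Q' : (smooth Q' 0)%:R * t 0 = 0 by rewrite /t dterm0// mulr0.
elim: Q => [|p Q IH] /=.
  move=> _ _; rewrite big_nil mulr1; apply/eqP; rewrite eq_le; apply/andP; split.
    apply: dsum_le => // N; apply: le_trans (_ : \sum_(0 <= n < N.+2) (smooth [::] n)%:R * t n <= _).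
      by rewrite !big_nat_recr//= -addrA lerDl addr_ge0 ?mulr_ge0 ?dterm_ge0.
    rewrite big_ltn// big_ltn// z0 /t dterm1 big_nat_cond big1 ?addr0 ?mulr1 ?add0r ?lexx//.
    move=> n /andP[/andP[n1 _] _]; rewrite /smooth.
    have : pdiv n \in primes n by rewrite mem_primes pdiv_prime// pdiv_dvd (ltnW n1).
    by case: (primes n) => //= *; rewrite mul0r.
  apply: le_trans (le_dsum 2 (sS [::])).
  by rewrite big_ltn// big_ltn// big_geq// z0 /t dterm1 add0r addr0 mulr1.
move=> /andP[ppr prQ] /andP[pQ uQ]; rewrite big_cons mulrA [_ * (1 - t p)]mulrC.
rewrite -(dsum_coprime (c := t p) (sS (p :: Q)) (z0 (p :: Q)) (prime_gt0 ppr)).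
- rewrite -[RHS](IH prQ uQ); congr (_ * _); apply: eq_dsum => n.
  have [->|n0] := posnP n; first by rewrite !z0 mulr0.
  have [pn|pn] := boolP (p %| n)%N; rewrite ?mul1r ?mul0r.
    rewrite /smooth (_ : all _ _ = false) ?mul0r//; apply/negbTE/allPn; exists p => //.
    by rewrite mem_primes ppr n0.
  congr ((nat_of_bool _)%:R * _); apply/idP/idP => /allP h; apply/allP => q qn.
    have := h _ qn; rewrite inE => /predU1P[qp|//].
    by move: qn; rewrite qp mem_primes (negbTE pn) !andbF.
  by rewrite inE h ?orbT.
- move=> m; have [->|m0] := posnP m; first by rewrite muln0 z0 mulr0.
  rewrite /t dtermM mulrCA; congr (_ * ((nat_of_bool _)%:R * _)).
  have pm q : (q \in primes (p * m)) = (q == p) || (q \in primes m).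
    by rewrite (primesM _ (prime_gt0 ppr) m0) (primes_prime ppr) inE.
  apply/idP/idP => /allP h; apply/allP => q qn.
    by apply: h; rewrite pm qn orbT.
  by move: qn; rewrite pm => /predU1P[->|/h//]; rewrite inE eqxx.
Qed.

(* Multiplying the integers of the class of [k] by the primes of [P] reaches each integer of the
   class of [k + 1] at most [k + 1] times. *)
Lemma dsum_omega_eq (Q P : seq nat) (k : nat) :
  all prime (Q ++ P) -> uniq (Q ++ P) ->
  (\sum_(p <- P) t p) ^+ k / k`!%:R * (dsum t * \prod_(p <- Q ++ P) (1 - t p)) <=
  dsum (fun n => ((omega Q n == 0%N) && (omega P n == k))%:R * t n).
Proof.
move=> prQP uQP; have uP : uniq P by move: uQP; rewrite cat_uniq => /and3P[].
have uQ : uniq Q by move: uQP; rewrite cat_uniq => /and3P[].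
pose g k n := ((omega Q n == 0%N) && (omega P n == k))%:R * t n.
have sg k' : summable (g k').
  by apply: summable_dtermM => n; rewrite ler0n lern1 leq_b1.
rewrite -[X in _ <= X]/(dsum (g k)).
have g0 k' : g k' 0%N = 0 by rewrite /g /t dterm0// mulr0.
elim: k => [|k IH].
  (* [B = 0] turns the Euler product identity into a sieve: [0 ^+ omega] is the indicator of
     [omega = 0]. *)
  rewrite expr0 fact0 divr1 mul1r -(@dsum_omega 0) ?lexx ?ler01//.
  rewrite [X in _ * X]big1 => [|p _]; last by rewrite mul0r subr0.
  rewrite mulr1; apply: ler_dsum => // n.
  rewrite mulr_ge0 ?exprn_ge0 ?dterm_ge0// expr0n omega_cat addn_eq0 /g.
  exact: lexx.
rewrite factS natrM invfM exprS.
set S := \sum_(p <- P) t p; set T := dsum t * _.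
have -> : S * S ^+ k * (k.+1%:R^-1 / k`!%:R) * T = k.+1%:R^-1 * (S * (S ^+ k / k`!%:R * T)).
  by ring.
rewrite ler_pdivrMl ?ltr0n//.
have S0 : 0 <= S by apply: sumr_ge0 => p _; exact: dterm_ge0.
apply: le_trans (ler_wpM2l S0 IH) _.
have prP p : p \in P -> prime p.
  by move=> pP; apply: (allP prQP); rewrite mem_cat pP orbT.
have -> : S * dsum (g k) = \sum_(p <- P) dsum (fun n => (p %| n)%N%:R * g k.+1 n).
  rewrite mulr_suml big_seq [RHS]big_seq; apply: eq_bigr => p pP.
  have ppr := prP _ pP.
  rewrite -dsum_dvd ?prime_gt0// -dsumZ//; apply: eq_dsum => m.
  have [->|m0] := posnP m; first by rewrite muln0 !g0 mulr0.
  rewrite /g /t dtermM [RHS]mulrCA !(omegaM _ (prime_gt0 ppr) m0) (omega_prime ppr uQ) (omega_prime ppr uP) pP.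
  rewrite (_ : p \in Q = false) ?add0n ?add1n ?eqSS//.
  by apply/negbTE; move: uQP; rewrite cat_uniq => /and3P[_ /hasPn/(_ _ pP)].
have sd p : summable (fun n => (p %| n)%N%:R * g k.+1 n).
  apply: (summable_le _ (sg k.+1)) => n.
  by case: (p %| n)%N; rewrite ?mul1r ?mul0r ?lexx ?(proj1 (sg _)).
have [sD <-] := dsum_sum P sd.
rewrite -dsumZ//; apply: ler_dsum => [n|]; last exact: summableZ.
apply/andP; split; first exact: (proj1 sD).
rewrite -mulr_suml; have [->|n0] := posnP n; first by rewrite g0 !mulr0.
rewrite /g; case: andP => [[_ /eqP nk]|_]; last by rewrite !mul0r !mulr0.
rewrite mul1r ler_wpM2r ?dterm_ge0// -natr_sum ler_nat -nk /omega.
rewrite big_seq [X in (_ <= X)%N]big_seq; apply: leq_sum => p pP.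
by case: (boolP (p %| n)%N) => // pn; rewrite lognE (prP _ pP) n0 pn.
Qed.

End euler.
End dirichlet.

(** * Mertens' estimates *)

Section mertens.
Context {R : realType}.

Definition primes_upto (N : nat) := [seq p <- index_iota 1 N.+1 | prime p].

Lemma mem_primes_upto N p : (p \in primes_upto N) = prime p && (p <= N)%N.
Proof.
rewrite mem_filter mem_index_iota ltnS; case: (boolP (prime p)) => //= ppr.
by rewrite prime_gt0.
Qed.

Lemma all_primes_upto N : all prime (primes_upto N).
Proof. exact: filter_all. Qed.

Lemma primes_upto_uniq N : uniq (primes_upto N).
Proof. by rewrite filter_uniq// iota_uniq. Qed.

Lemma ler_prod_seq (I : eqType) (s : seq I) (E1 E2 : I -> R) :
  (forall i, i \in s -> 0 <= E1 i <= E2 i) ->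
  \prod_(i <- s) E1 i <= \prod_(i <- s) E2 i.
Proof. by move=> h; rewrite big_seq [X in _ <= X]big_seq; apply: ler_prod. Qed.

(** [1 / n^2 <= 1 / (n - 1) - 1 / n] telescopes from [n = 2]. *)
Lemma sum_prime_sqr_le N : \sum_(p <- primes_upto N) (p%:R^-1 : R) ^+ 2 <= 1.
Proof.
rewrite /primes_upto big_filter.
suff h M : \sum_(1 <= p < M.+2 | prime p) (p%:R^-1 : R) ^+ 2 <= 1 - M.+1%:R^-1.
  case: N => [|N]; first by rewrite big_geq.
  by apply: le_trans (h N) _; rewrite gerBl invr_ge0.
elim: M => [|M IH].
  by rewrite big_mkcond/= big_nat1 invr1 subrr.
rewrite big_mkcond/= big_nat_recr//= -big_mkcond/=.
apply: le_trans (_ : 1 - M.+1%:R^-1 + (M.+2%:R^-1) ^+ 2 <= _).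
  by rewrite lerD//; case: ifP => // _; rewrite sqr_ge0.
rewrite -addrA lerD2l.
have M1 : 0 < (M.+1%:R : R) by rewrite ltr0n.
rewrite -[M.+2%:R]natr1; move: (M.+1%:R) M1 => x x0.
have x1 : 0 < x + 1 by lra.
rewrite lerNr opprD opprK -subr_ge0.
have -> : x^-1 - (x + 1)^-1 ^+ 2 - (x + 1)^-1 = (x * (x + 1) ^+ 2)^-1.
  by field; rewrite !gt_eqF.
by rewrite invr_ge0 mulr_ge0 ?sqr_ge0 ?ltW.
Qed.

(** On [[0, 1/2]] one has [1 - x >= exp(- x - 2 x^2)], because [(1 - x) (1 + x + 2 x^2) = 1 + x^2 (1
    - 2 x)]; the squares add up to at most 1. *)
Lemma prod_dterm_ge (delta : R) N : 0 <= delta ->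
  expR (- (\sum_(p <- primes_upto N) dterm delta p) - 2) <=
  \prod_(p <- primes_upto N) (1 - dterm delta p).
Proof.
move=> d0.
apply: le_trans (_ : expR (\sum_(p <- primes_upto N) - (dterm delta p + 2 * dterm delta p ^+ 2)) <= _).
  rewrite ler_expR sumrN -opprD lerN2 big_split/= lerD2l -mulr_sumr.
  suff : \sum_(p <- primes_upto N) dterm delta p ^+ 2 <= 1 by lra.
  apply: le_trans (sum_prime_sqr_le N).
  rewrite big_seq [X in _ <= X]big_seq; apply: ler_sum => p.
  rewrite mem_primes_upto => /andP[ppr _].
  by rewrite ler_sqr ?nnegrE ?dterm_ge0 ?invr_ge0// dterm_le_inv// prime_gt0.
rewrite expR_sum; apply: ler_prod_seq => p; rewrite mem_primes_upto => /andP[ppr _].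
rewrite expR_ge0/=.
have := dterm_le_half d0 (prime_gt1 ppr); have := dterm_ge0 delta p.
move: (dterm delta p) => x x0 x2.
have y0 := expR_gt0 (x + 2 * x ^+ 2).
rewrite expRN -[X in X <= _]mul1r ler_pdivrMr//.
apply: le_trans (_ : (1 - x) * (1 + (x + 2 * x ^+ 2)) <= _); last first.
  by rewrite ler_wpM2l ?expR_ge1Dx//; lra.
rewrite -subr_ge0 (_ : _ - _ = x ^+ 2 * (1 - 2 * x)); last by ring.
by rewrite mulr_ge0 ?sqr_ge0//; lra.
Qed.

Lemma prod_dterm_le (delta : R) (Q : seq nat) : 0 <= delta -> all prime Q ->
  \prod_(p <- Q) (1 - dterm delta p) <= expR (- \sum_(p <- Q) dterm delta p).
Proof.
move=> d0 prQ; rewrite -sumrN expR_sum; apply: ler_prod_seq => p pQ.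
have := dterm_lt1 d0 (prime_gt1 (allP prQ _ pQ)).
by have := expR_ge1Dx (- dterm delta p) => h1 h2; apply/andP; split; lra.
Qed.

Lemma ln2_le1 : ln (2 : R) <= 1.
Proof. by have := @le_ln1Dx R 1; rewrite (_ : 1 + 1 = 2)//; apply; lra. Qed.

Lemma truncn_expR_gt0 (L : R) : 0 <= L -> (0 < Num.truncn (expR L))%N.
Proof.
by move=> L0; rewrite truncn_gt0 -expR0 ler_expR.
Qed.

Lemma ln_truncn_expR (L : R) : 0 <= L -> ln (Num.truncn (expR L))%:R <= L.
Proof.
move=> L0; rewrite -[X in _ <= X]expRK ler_ln ?posrE ?expR_gt0 ?ltr0n ?truncn_expR_gt0//.
by rewrite truncn_le// expR_ge0.
Qed.

Lemma ln_truncnS_expR (L : R) : L <= ln (Num.truncn (expR L)).+1%:R.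
Proof.
rewrite -[X in X <= _]expRK ler_ln ?posrE ?expR_gt0 ?ltr0n//.
by rewrite ltW// truncnS_gt.
Qed.

(** At [1 / L] the integers up to [exp L], all smooth for these primes, contribute at least [L / 2]
    to a series equal to the inverse Euler product, which is at most [exp(S + 2)]. The 3 is
    [2 + ln 2] rounded up. *)
Lemma sum_prime_dterm_ge (L delta : R) : 1 <= L -> 0 <= delta <= L^-1 ->
  ln L - 3 <= \sum_(p <- primes_upto (Num.truncn (expR L))) dterm delta p.
Proof.
move=> L1 /andP[d0 dL]; have L0 : 0 < L by lra.
set N := Num.truncn (expR L).
apply: (@le_trans _ _ (\sum_(p <- primes_upto N) dterm L^-1 p)); last first.
  rewrite big_seq [X in _ <= X]big_seq; apply: ler_sum => p.
  by rewrite mem_primes_upto => /andP[ppr _]; rewrite ler_dterm// prime_gt0.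
have d1 : 0 < L^-1 by rewrite invr_gt0.
have := dsum_smooth d1 (all_primes_upto N) (primes_upto_uniq N).
set U := dsum _; have UL : L / 2 <= U.
  have -> : L / 2 = (2 * L^-1)^-1 by rewrite invfM invrK mulrC.
  apply: le_trans (sum_dterm_ge (N := N) d1 _) _.
    by rewrite ler_pdivlMl// mulr1 ln_truncnS_expR.
  apply: le_trans (le_dsum N.+1 _); last first.
    by apply: summable_dtermM => // n; rewrite ler0n lern1 leq_b1.
  rewrite sum_nat1 ?dterm0 ?mulr0// [X in X <= _]big_nat_cond [X in _ <= X]big_nat_cond.
  apply: ler_sum => n /andP[/andP[n0 nN] _].
  rewrite (_ : smooth _ _) ?mul1r//; apply/allP => p.
  rewrite mem_primes mem_primes_upto => /and3P[-> _ /(dvdn_leq n0) pn]/=.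
  exact: leq_trans pn _.
move=> UE; have := prod_dterm_ge N (ltW d1).
set P := \prod_(p <- _) _ in UE *; set S := \sum_(p <- _) _ => hP.
have h : L / 2 * expR (- S - 2) <= 1.
  by rewrite -[X in _ <= X]UE; apply: ler_pM; rewrite ?expR_ge0//; lra.
have : ln (L / 2 * expR (- S - 2)) <= 0 by exact: ln_le0.
rewrite lnM ?posrE ?expR_gt0 ?divr_gt0// expRK ln_div ?posrE//.
have := ln2_le1; lra.
Qed.

(** At [1 / L] the series over integers free of these primes is at least 1, from the term [n = 1],
    and at most [2 L exp(- S)]; so [S <= ln L + 1]. Replacing the exponent [1 + 1 / L] by 1 costs at
    most [(1 / L) * sum of (ln p) / p <= (L + 4) / L <= 5]. *)
Lemma sum_prime_inv_le (L : R) : 1 <= L ->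
  \sum_(p <- primes_upto (Num.truncn (expR L))) (p%:R : R)^-1 <= ln L + 6.
Proof.
move=> L1; have L0 : 0 < L by lra.
set N := Num.truncn (expR L); set d := L^-1.
have d0 : 0 < d by rewrite invr_gt0.
have hS : \sum_(p <- primes_upto N) dterm d p <= ln L + 1.
  have := @dsum_omega R d d0 0 _ _ (all_primes_upto N) (primes_upto_uniq N).
  rewrite lexx ler01 => /(_ isT).
  rewrite [X in _ * X]big1 => [|p _]; last by rewrite mul0r subr0.
  rewrite mulr1; set T := dsum _ => TE.
  have T1 : 1 <= T.
    apply: le_trans (le_dsum 2 _); last first.
      by apply: summable_dtermM => // n; rewrite exprn_ge0//= exprn_ile1.
    rewrite big_ltn// big_ltn// big_geq// dterm0// dterm1 mulr0 add0r addr0 mulr1.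
    rewrite /omega big1 ?expr0// => p _; exact: logn1.
  have ZL : dsum (dterm d) <= 2 * L.
    apply: le_trans (dsum_le (summable_dterm d0) (fun N => sum_dterm_le N d0)) _.
    by rewrite invrK; lra.
  have h : 1 <= 2 * L * expR (- \sum_(p <- primes_upto N) dterm d p).
    apply: le_trans T1 _; rewrite TE; apply: ler_pM => //.
    - exact: dsum_ge0 (summable_dterm d0).
    - by apply: le_trans (prod_dterm_ge N (ltW d0)); exact: expR_ge0.
    - exact: prod_dterm_le (ltW d0) (all_primes_upto N).
  have : 0 <= ln (2 * L * expR (- \sum_(p <- primes_upto N) dterm d p)) by exact: ln_ge0.
  rewrite !lnM ?posrE ?expR_gt0 ?mulr_gt0// expRK.
  have := ln2_le1; lra.
suff : \sum_(p <- primes_upto N) ((p%:R : R)^-1 - dterm d p) <= 5.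
  by rewrite sumrB; lra.
apply: (@le_trans _ _ (\sum_(p <- primes_upto N) d * (ln p%:R / p%:R))).
  rewrite big_seq [X in _ <= X]big_seq; apply: ler_sum => p.
  rewrite mem_primes_upto => /andP[ppr _]; rewrite dtermE ?prime_gt0//.
  have := expR_ge1Dx (- d * ln (p%:R : R)); have : 0 <= (p%:R : R)^-1 by rewrite invr_ge0.
  move: (ln _) (expR (- d * _)) (p%:R^-1) => z y x x0 h.
  have := ler_wpM2l x0 h; lra.
rewrite -mulr_sumr /primes_upto big_filter ler_pdivrMl//.
apply: le_trans (sum_ln_prime_div_le (truncn_expR_gt0 (ltW L0))) _.
by have := ln_truncn_expR (ltW L0); lra.
Qed.

(** Rankin's trick: [omega <= k] implies [B ^+ k <= B ^+ omega]. The constant is 5 from the mean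
    value bound, [e] from inserting [m^(1 / ln N) <= e], and 2 from the bound [1 + ln N <= 2 ln N]
    on the full series. *)
Lemma count_omega_le (B : R) (Q : seq nat) (k N : nat) : 0 <= B <= 1 ->
  all prime Q -> uniq Q -> 1 <= ln (N%:R : R) ->
  (\sum_(1 <= m < N.+1) (omega Q m <= k)%N)%:R * B ^+ k <=
  10 * expR 1 * N%:R * expR (- (1 - B) * \sum_(p <- Q) dterm (ln N%:R)^-1 p).
Proof.
move=> /andP[B0 B1] prQ uQ lN; set l := ln (N%:R : R) in lN *.
have l0 : 0 < l by lra.
have d0 : 0 < l^-1 by rewrite invr_gt0.
pose f m : R := B ^+ omega Q m.
have f01 m : 0 <= f m <= 1 by rewrite exprn_ge0//= exprn_ile1.
apply: (@le_trans _ _ (\sum_(1 <= m < N.+1) f m)).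
  rewrite natr_sum mulr_suml; apply: ler_sum => m _.
  case: leqP => h; last by rewrite mul0r exprn_ge0.
  by rewrite mul1r /f; exact: ler_wiXn2l.
have := @submult_mean_le R f N (fun m => (andP (f01 m)).1); rewrite -/l => h.
have {}h : l * \sum_(1 <= m < N.+1) f m <= 5 * N%:R * \sum_(1 <= m < N.+1) f m / m%:R.
  apply: h => d j dp jp; rewrite /f omegaM// exprD ler_piMl ?exprn_ge0//.
  by rewrite exprn_ile1.
have h1 : \sum_(1 <= m < N.+1) f m / m%:R <= expR 1 * dsum (fun m => f m * dterm l^-1 m).
  have sf : summable (fun m => f m * dterm l^-1 m) by exact: summable_dtermM.
  apply: le_trans (ler_wpM2l (expR_ge0 1) (le_dsum N.+1 sf)).
  rewrite sum_nat1 ?dterm0 ?mulr0// mulr_sumr.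
  rewrite [X in X <= _]big_nat_cond [X in _ <= X]big_nat_cond.
  apply: ler_sum => m /andP[/andP[m0 mN] _].
  rewrite mulrCA ler_wpM2l ?(andP (f01 m)).1// dtermE// mulrCA -expRD.
  rewrite ler_peMr ?invr_ge0// -[X in X <= _]expR0 ler_expR mulNr.
  suff : l^-1 * ln m%:R <= 1 by lra.
  by rewrite ler_pdivrMl// mulr1 ler_ln ?posrE ?ltr0n ?ler_nat//; lia.
have h2 : dsum (fun m => f m * dterm l^-1 m) <=
    2 * l * expR (- (1 - B) * \sum_(p <- Q) dterm l^-1 p).
  have := @dsum_omega R _ d0 B Q _ prQ uQ; rewrite B0 B1 => /(_ isT) E.
  have tB p : p \in Q -> 0 < 1 - B * dterm l^-1 p.
    move=> pQ; have := dterm_lt1 (ltW d0) (prime_gt1 (allP prQ _ pQ)).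
    by have := dterm_ge0 l^-1 p; move: (dterm _ _) => x x0 x1; nra.
  have P0 : 0 < \prod_(p <- Q) (1 - B * dterm l^-1 p).
    by rewrite big_seq; apply: prodr_gt0.
  rewrite -(ler_pM2r P0) E -[X in _ <= X]mulrA ler_pM//.
  - exact: dsum_ge0 (summable_dterm d0).
  - rewrite big_seq; apply: prodr_ge0 => p pQ.
    by have := dterm_lt1 (ltW d0) (prime_gt1 (allP prQ _ pQ)); lra.
  - apply: le_trans (dsum_le (summable_dterm d0) (fun N => sum_dterm_le N d0)) _.
    by rewrite invrK; lra.
  (* Factor by factor, with [x = dterm l^-1 p]: [1 - x <= (1 - (1 - B) x) (1 - B x)], the difference
     being [B (1 - B) x^2]. *)
  - rewrite mulr_sumr expR_sum -big_split/=; apply: ler_prod_seq => p pQ.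
    have t1 := dterm_lt1 (ltW d0) (prime_gt1 (allP prQ _ pQ)).
    have := tB _ pQ; have := dterm_ge0 l^-1 p; move: (dterm _ _) t1 => x x1 x0 Bx.
    rewrite subr_ge0 ltW//=.
    apply: le_trans (_ : (1 + - (1 - B) * x) * (1 - B * x) <= _); last first.
      by rewrite ler_pM2r// expR_ge1Dx.
    rewrite -subr_ge0 (_ : _ - _ = B * (1 - B) * x ^+ 2); last by ring.
    by rewrite mulr_ge0 ?sqr_ge0 ?mulr_ge0//; lra.
rewrite -(ler_pM2l l0); apply: le_trans h _.
apply: le_trans (ler_wpM2l _ h1) _; first by rewrite mulr_ge0.
apply: le_trans (_ : 5 * N%:R * (expR 1 * (2 * l * expR (- (1 - B) * \sum_(p <- Q) dterm l^-1 p))) <= _).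
  by rewrite !ler_wpM2l ?mulr_ge0 ?expR_ge0.
by rewrite le_eqVlt; apply/orP; left; apply/eqP; ring.
Qed.

End mertens.

(** * Counting functions *)

Section counting.
Context {R : realType}.
Implicit Types (P Q : set nat) (N K : nat) (x : R).

Definition cnt P N := (\sum_(1 <= m < N.+1) `[< P m >])%N.

Lemma count_uptoE P x : 0 <= x -> count_upto P x = cnt P (Num.truncn x).
Proof.
move=> x0; rewrite /count_upto /cnt.
set X := _ `&` _; have finX : finite_set X by exact: finite_upto.
transitivity (size [seq m <- index_iota 1 (Num.truncn x).+1 | `[< P m >]]).
  apply: perm_size; apply: uniq_perm; rewrite ?fset_uniq ?filter_uniq ?iota_uniq// => m.
  rewrite in_fset_set// mem_filter mem_index_iota ltnS truncn_ge_nat//.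
  apply/idP/idP => [/set_mem[Pm /= /andP[m1 mx]]|/and3P[/asboolP Pm m1 mx]].
    by rewrite mx andbT asboolT//=; move: m1; rewrite ler1n.
  by apply/mem_set; split=> //=; rewrite mx ler1n m1.
by rewrite size_filter -sum1_count big_mkcond; apply: eq_bigr => m _; case: asboolP.
Qed.

Lemma cntC P N : (cnt P N + cnt (~` P) N)%N = N.
Proof.
rewrite /cnt -big_split/=.
rewrite (eq_bigr (fun=> 1%N)); first by rewrite sum_nat_const_nat subn1 muln1.
by move=> m _; case: asboolP => Pm; case: asboolP.
Qed.

Lemma cnt_sub P Q N : (forall m, (0 < m <= N)%N -> P m -> Q m) -> (cnt P N <= cnt Q N)%N.
Proof.
move=> PQ; rewrite /cnt big_nat_cond [X in (_ <= X)%N]big_nat_cond.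
apply: leq_sum => m /andP[mN _]; case: asboolP => // Pm.
by rewrite asboolT//; exact: PQ Pm.
Qed.

Lemma cntU P Q N : (cnt (P `|` Q) N <= cnt P N + cnt Q N)%N.
Proof.
rewrite /cnt -big_split/=; apply: leq_sum => m _.
by case: asboolP => // -[] h; rewrite (asboolT h) ?leq_addr ?leq_addl.
Qed.

Lemma cnt_leq K N : (cnt [set m | (m <= K)%N] N <= K)%N.
Proof.
rewrite /cnt; elim: N => [|N IH]; first by rewrite big_geq.
rewrite big_nat_recr//=; case: asboolP => /= NK; last by rewrite addn0.
apply: leq_trans NK; rewrite addn1 ltnS.
apply: leq_trans (_ : \sum_(1 <= m < N.+1) 1 <= _)%N.
  by apply: leq_sum => m _; exact: leq_b1.
by rewrite sum_nat_const_nat subn1 muln1.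
Qed.

Lemma ln_half (y : R) : 0 < y -> ln y <= y / 2.
Proof.
move=> y0; have := @le_ln1Dx R (y / 2 - 1).
rewrite (_ : 1 + (y / 2 - 1) = y / 2); last by ring.
rewrite ln_div ?posrE// => h.
have := @ln2_le1 R; have : -1 < y / 2 - 1 by lra.
move=> /h; lra.
Qed.

(* Every [m > N / ln N] satisfies [ln m >= ln N / 2]. *)
Lemma cnt_large P N : 1 <= ln (N%:R : R) ->
  (cnt P N)%:R <= N%:R / ln N%:R +
    (cnt (P `&` [set m | ln (N%:R : R) / 2 <= ln m%:R]) N)%:R :> R.
Proof.
move=> lN; have N0 : (0 < N)%N by case: N lN => //; rewrite ln0//; lra.
have N0R : 0 < (N%:R : R) by rewrite ltr0n.
set l := ln (N%:R : R) in lN *; have l0 : 0 < l by lra.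
set K := Num.truncn (N%:R / l).
have h : (cnt P N <= cnt [set m | (m <= K)%N] N +
    cnt (P `&` [set m | (l / 2 <= ln (m%:R : R))%R]) N)%N.
  apply: leq_trans (cntU _ _ _); apply: cnt_sub => m /andP[m0 mN] Pm.
  have [mK|Km] := leqP m K; [by left|right; split => //=].
  have {}Km : N%:R / l <= m%:R by rewrite ltW// (lt_le_trans (truncnS_gt _))// ler_nat.
  have : ln (N%:R / l) <= ln m%:R by rewrite ler_ln ?posrE ?ltr0n// divr_gt0.
  by rewrite ln_div ?posrE//; have := ln_half l0; rewrite -/l; lra.
move: h; rewrite -(ler_nat R) natrD => /le_trans; apply; rewrite lerD2r.
apply: (@le_trans _ _ K%:R); first by rewrite ler_nat cnt_leq.
by rewrite truncn_le divr_ge0// ltW.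
Qed.

End counting.

(** * The set A and the density of its complement *)

Section density.
Context {R : realType}.
Implicit Types (a l r : R) (N m p : nat).

Lemma powRN_half l a : 0 < l -> 0 <= a <= 1 -> (l / 2) `^ (- a) <= 2 * l `^ (- a).
Proof.
move=> l0 /andP[a0 a1]; rewrite powRM ?invr_ge0 ?(ltW l0)// [X in X <= _]mulrC ler_pM2r ?powR_gt0//.
rewrite -powR_inv1// -powRrM mulN1r opprK -[X in _ <= X]powRr1//.
by rewrite ler_powR ?ler1n.
Qed.

Lemma inv_le_powRN l a : 1 <= l -> a <= 1 -> l^-1 <= l `^ (- a).
Proof.
move=> l1 a1; rewrite -powR_inv1; last by lra.
by rewrite ler_powR// lerN2.
Qed.

Definition llprimes r := primes_upto (Num.truncn (expR (expR r))).

Lemma mem_llprimes r p : (p \in llprimes r) = prime p && (ln p%:R <= expR r).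
Proof.
rewrite mem_primes_upto; case: (boolP (prime p)) => //= ppr.
rewrite truncn_ge_nat ?expR_ge0// -[in RHS](expRK (expR r)) ler_ln ?posrE ?expR_gt0//.
by rewrite ltr0n prime_gt0.
Qed.

(** The condition on [N] lets the Mertens lower bound apply at [1 / ln N], so the prime sum is at
    least [r - 3]; the loss is at most [exp 3], hence [expR 4] in place of [expR 1]. *)
Lemma cnt_omega_llprimes (B r : R) (k N : nat) : 0 <= B <= 1 -> 0 <= r ->
  expR r <= ln (N%:R : R) ->
  (cnt [set m | (omega (llprimes r) m <= k)%N] N)%:R * B ^+ k <=
  10 * expR 4 * N%:R * expR (- (1 - B) * r).
Proof.
move=> /andP[B0 B1] r0 rN.
have e1 : 1 <= expR r by rewrite -expR0 ler_expR.
have lN : 1 <= ln (N%:R : R) by exact: le_trans rN.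
have l0 : 0 < ln (N%:R : R) by lra.
have := @count_omega_le R B (llprimes r) k N.
rewrite B0 B1 => /(_ isT (all_primes_upto _) (primes_upto_uniq _) lN).
rewrite (_ : cnt _ N = \sum_(1 <= m < N.+1) (omega (llprimes r) m <= k))%N; last first.
  by apply: eq_bigr => m _; rewrite asboolb.
move=> /le_trans; apply.
rewrite (_ : 10 * expR 4 * _ * _ = 10 * expR 1 * N%:R * (expR 3 * expR (- (1 - B) * r))); last first.
  have -> : 4 = 1 + 3 :> R by ring.
  by rewrite expRD; ring.
rewrite ler_wpM2l ?mulr_ge0 ?expR_ge0// -expRD ler_expR.
have := @sum_prime_dterm_ge R (expR r) (ln N%:R)^-1 e1.
rewrite invr_ge0 (ltW l0) lef_pV2 ?posrE ?expR_gt0// rN => /(_ isT).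
by rewrite expRK -/(llprimes r); move: (\sum_(p <- _) _) => S; nra.
Qed.

(** The condition is vacuous at 1. Thus [avoiding] omits 1, and the trivial factorisation
    [n = 1 * n] does not put A inside A.A. *)
Definition bad1 a : set nat :=
  [set m | forall p, prime p -> (p %| m)%N -> ln (m%:R : R) `^ a < ln p%:R].

(** For [ln m >= l / 2] such an [m] has no prime factor with [ln p <= (l / 2)^a]; the bound with
    [B = 0] and [k = 0] sieves these out, leaving the proportion [(l / 2)^-a]. *)
Lemma cnt_bad1 a N : 0 < a <= 1 -> 2 <= ln (N%:R : R) ->
  (cnt (bad1 a) N)%:R <= (1 + 20 * expR 4) * N%:R * ln N%:R `^ (- a).
Proof.
move=> /andP[a0 a1] lN; apply: le_trans (cnt_large _ _) _; first by lra.
set l := ln (N%:R : R) in lN *.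
have l2 : 1 <= l / 2 by lra.
have h0 : 0 < (l / 2) `^ a by rewrite powR_gt0; lra.
have h1 : 1 <= (l / 2) `^ a by rewrite -[X in X <= _](powRr0 (l / 2)) ler_powR// ltW.
pose r := ln ((l / 2) `^ a); have rE : expR r = (l / 2) `^ a by rewrite lnK.
have := @cnt_omega_llprimes 0 r 0 N.
rewrite lexx ler01 ln_ge0// => /(_ isT isT); rewrite rE -/l.
have -> : (l / 2) `^ a <= l by apply: le_trans (ler1_powR l2 a1) _; lra.
move=> /(_ isT); rewrite expr0 mulr1 subr0 mulN1r expRN rE => h.
have {h} : (cnt (bad1 a `&` [set m | l / 2 <= ln m%:R]) N)%:R <=
    10 * expR 4 * N%:R / (l / 2) `^ a.
  apply: le_trans h; rewrite ler_nat; apply: cnt_sub => m /andP[m0 mN] [b1 /= lm].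
  rewrite leqn0 sum_nat_seq_eq0; apply/allP => p; rewrite mem_llprimes rE => /andP[ppr pl].
  rewrite lognE ppr m0/=; case: ifP => // pm; exfalso.
  have := b1 _ ppr pm; rewrite ltNge => /negP; apply; apply: le_trans pl _.
  by apply: ge0_ler_powR => //; rewrite ?nnegrE; lra.
rewrite -powRN => h.
have h2 : 10 * expR 4 * N%:R * (l / 2) `^ (- a) <= 10 * expR 4 * N%:R * (2 * l `^ (- a)).
  by rewrite ler_wpM2l ?mulr_ge0 ?expR_ge0// powRN_half //; lra.
have h3 : N%:R / l <= N%:R * l `^ (- a) by rewrite ler_wpM2l// inv_le_powRN//; lra.
move: h h2 h3; move: (N%:R : R) => x h h2 h3.
apply: le_trans (lerD h3 (le_trans h h2)) _.
by rewrite le_eqVlt; apply/orP; left; apply/eqP; ring.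
Qed.

Section construction.
Variables (a w eps B : R) (M : nat).
Hypotheses (a0 : 0 < a) (a1 : a < 1) (w0 : 0 < w) (eps0 : 0 < eps) (B01 : 0 <= B <= 1).
Hypothesis wB : phi B * w = (1 + eps) * a.

(** A scale is a value of [ln ln], so geometric growth here makes the integers concerned extremely
    sparse. *)
Definition scale (k : nat) : R := (M ^ k)%:R.

Hypothesis M0 : (0 < M)%N.
Hypothesis scaleS : forall k, (2 + eps) * scale k <= w * scale k.+1.

(** Below the window, a factor of a structured integer falls under [bad1]. Its upper end is the
    height at which the Dirichlet series is cut off; there [wB] makes the density
    [exp(- phi(B) w s)] equal to [(ln m)^-a]. *)
Definition bad2 : set nat := [set m | exists k,
  [/\ expR (w * scale k) < ln (m%:R : R), ln (m%:R : R) <= expR ((1 + eps) * scale k)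
    & (omega (llprimes (w * scale k)) m)%:R <= B * w * scale k]].

Definition avoiding : set nat := ~` (bad1 a `|` bad2).

Lemma scale_ge1 k : 1 <= scale k.
Proof. by rewrite ler1n expn_gt0 M0. Qed.

(** By [scaleS] the windows of distinct scales stay apart even after the loss of a factor 2 in
    [ln m]: the [2] of [2 + eps] leaves room for [exp(s) >= 2]. *)
Lemma scale_lt_inj k k' N : ln (N%:R : R) / 2 <= expR ((1 + eps) * scale k) ->
  expR (w * scale k') < ln (N%:R : R) -> (k' <= k)%N.
Proof.
have [[a0' a1'] [w0' eps0']] := ((a0, a1), (w0, eps0)).
move=> h1 h2; rewrite leqNgt; apply/negP => kk'.
have s1 := scale_ge1 k.
have : (2 + eps) * scale k <= w * scale k'.
  apply: le_trans (scaleS k) _.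
  by rewrite ler_pM2l// ler_nat leq_pexp2l.
rewrite -ler_expR => h4.
have : 2 * expR ((1 + eps) * scale k) <= expR ((2 + eps) * scale k).
  rewrite (_ : (2 + eps) * _ = scale k + (1 + eps) * scale k); last by ring.
  rewrite expRD ler_pM2r ?expR_gt0//.
  by have := expR_ge1Dx (scale k); lra.
lra.
Qed.

Lemma cnt_bad2 N : 2 <= ln (N%:R : R) ->
  (cnt bad2 N)%:R <= (1 + 20 * expR 4) * N%:R * ln N%:R `^ (- a).
Proof.
have [[a0' a1'] [w0' eps0']] := ((a0, a1), (w0, eps0)).
move=> lN; apply: le_trans (cnt_large _ _) _; first by lra.
set l := ln (N%:R : R) in lN *.
have /andP[B0 B1] := B01.
have h3 : N%:R / l <= N%:R * l `^ (- a) by rewrite ler_wpM2l// inv_le_powRN//; lra.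
set X := bad2 `&` _.
(* One surviving element [m0] fixes the scale [k], which all the other surviving elements must then
   share. *)
have [[m0 [/andP[m00 m0N] [[k [hk1 hk2 _]] /= hl]]]|none] :=
  pselect (exists m, (0 < m <= N)%N /\ X m); last first.
  have -> : cnt X N = 0%N.
    apply/eqP; rewrite -leqn0; apply: leq_trans (cnt_leq 0 N); apply: cnt_sub => m mN Xm.
    by case: none; exists m.
  rewrite addr0; apply: le_trans h3 _; rewrite -mulrA ler_peMl//.
    by rewrite mulr_ge0 ?powR_ge0.
  by rewrite lerDl mulr_ge0 ?expR_ge0.
have lm0 : ln (m0%:R : R) <= l.
  by rewrite ler_ln ?posrE ?ltr0n ?ler_nat// (leq_trans m00).
set s := scale k in hk1 hk2 *; have s1 : 1 <= s := scale_ge1 k.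
have ws0 : 0 <= w * s by rewrite mulr_ge0; lra.
pose K := Num.truncn (B * w * s).
have Bws0 : 0 <= B * w * s by rewrite -mulrA mulr_ge0.
have := @cnt_omega_llprimes B (w * s) K N B01 ws0.
rewrite -/l => /(_ (ltW (lt_le_trans hk1 lm0))) h.
have hX : (cnt X N <= cnt [set m | (omega (llprimes (w * s)) m <= K)%N] N)%N.
  apply: cnt_sub => m /andP[m1 mN] [[k' [h1 h2 h4]] /= h5].
  have lm : ln (m%:R : R) <= l.
    by rewrite ler_ln ?posrE ?ltr0n ?ler_nat// (leq_trans m1).
  suff kk' : k' = k by rewrite truncn_ge_nat// /s -kk'.
  apply/eqP; rewrite eqn_leq; apply/andP; split.
    by apply: (@scale_lt_inj _ _ N); [exact: le_trans hl hk2|exact: lt_le_trans h1 lm].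
  by apply: (@scale_lt_inj _ _ N); [exact: le_trans h5 h2|exact: lt_le_trans hk1 lm0].
(* [K <= B w s] and [ln B <= 0]. For [B = 0] the exponent [K] is 0 and both sides equal 1. *)
have BK : expR (B * w * s * ln B) <= B ^+ K.
  have [B00|Bn0] := eqVneq B 0; first by rewrite /K B00 !mul0r expR0 truncn0 expr0.
  have Bp : 0 < B by rewrite lt_neqAle eq_sym Bn0.
  rewrite -[X in _ <= X](lnK (exprn_gt0 _ Bp)) ler_expR lnXn// -mulr_natl.
  rewrite ler_wnM2r ?ln_le0//; by rewrite truncn_le.
have h6 : (cnt X N)%:R * expR (B * w * s * ln B) <= 10 * expR 4 * N%:R * expR (- (1 - B) * (w * s)).
  by apply: le_trans h; apply: ler_pM; rewrite ?expR_ge0 ?ler_nat.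
have h7 : (cnt X N)%:R <= 10 * expR 4 * N%:R * expR (- ((1 + eps) * s * a)).
  rewrite -(ler_pM2r (expR_gt0 (B * w * s * ln B))); apply: le_trans h6 _.
  rewrite -[X in _ <= X]mulrA -expRD.
  rewrite (_ : - (1 - B) * (w * s) = - ((1 + eps) * s * a) + B * w * s * ln B)//.
  rewrite (_ : (1 + eps) * s * a = (phi B * w) * s); last by rewrite wB; ring.
  by rewrite phiE; ring.
(* The window of [m0] gives [l / 2 <= ln m0 <= exp((1 + eps) s)]. *)
have h8 : expR (- ((1 + eps) * s * a)) <= (l / 2) `^ (- a).
  have l20 : 0 < l / 2 by lra.
  rewrite expRN powRN lef_pV2 ?posrE ?expR_gt0 ?powR_gt0// expRM.
  by apply: ge0_ler_powR; rewrite ?nnegrE ?expR_ge0 ?(ltW a0) ?(ltW l20)// (le_trans hl).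
have h2 : (l / 2) `^ (- a) <= 2 * l `^ (- a) by rewrite powRN_half //; lra.
have h9 : 10 * expR 4 * N%:R * expR (- ((1 + eps) * s * a)) <= 10 * expR 4 * N%:R * (2 * l `^ (- a)).
  by rewrite ler_wpM2l ?mulr_ge0 ?expR_ge0// (le_trans h8).
apply: le_trans (lerD h3 (le_trans h7 h9)) _.
by rewrite le_eqVlt; apply/orP; left; apply/eqP; ring.
Qed.

Lemma avoiding_compl_ll : compl_ll avoiding a.
Proof.
have [[a0' a1'] [w0' eps0']] := ((a0, a1), (w0, eps0)).
(* The 1 pays for truncating [x], since [1 <= x (ln x)^-a]; the 4 is 2 for the two omitted sets
   times 2 for [ln N >= (ln x) / 2]. *)
exists (1 + 4 * (1 + 20 * expR 4)); near=> x.
have x4 : expR 4 <= x by near: x; exact: nbhs_pinfty_ge.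
have x0 : 0 < x by apply: lt_le_trans x4; exact: expR_gt0.
have lx : 4 <= ln x by rewrite -[X in X <= _]expRK ler_ln ?posrE ?expR_gt0.
set N := Num.truncn x.
have Nx : N%:R <= x by rewrite truncn_le ltW.
have xN : x < N.+1%:R := truncnS_gt x.
have x2N : x / 2 <= N%:R.
  by move: xN; rewrite -natr1; have := expR_ge1Dx (4 : R); lra.
have lxN : ln x / 2 <= ln N%:R.
  have h : ln (x / 2) <= ln N%:R by rewrite ler_ln ?posrE//; lra.
  by move: h; rewrite ln_div ?posrE//; have := @ln2_le1 R; lra.
rewrite /rel_compl count_uptoE ?(ltW x0)// -/N.
have NE : (cnt avoiding N)%:R = N%:R - (cnt (bad1 a `|` bad2) N)%:R :> R.
  by rewrite -[in X in X - _](cntC avoiding N) natrD setCK addrK.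
have lN2 : 2 <= ln (N%:R : R) by lra.
have : (cnt (bad1 a `|` bad2) N)%:R <= 2 * ((1 + 20 * expR 4) * N%:R * ln N%:R `^ (- a)).
  apply: le_trans (_ : (cnt (bad1 a) N + cnt bad2 N)%:R <= _).
    by rewrite ler_nat cntU.
  have := cnt_bad2 lN2; have := @cnt_bad1 a N _ lN2; rewrite a0 (ltW a1) => /(_ isT).
  move=> h1 h2; have := lerD h1 h2.
  by rewrite natrD -[X in _ <= X -> _]mulr2n -[X in _ <= X -> _]mulr_natl.
have c0 : 0 <= (cnt (bad1 a `|` bad2) N)%:R :> R by [].
rewrite NE; move: (cnt _ _)%:R c0 => c c0 hc.
rewrite ger0_norm; last by rewrite subr_ge0 ler_pdivrMr// mul1r; lra.
have -> : 1 - (N%:R - c) / x = (x - N%:R + c) / x by field; rewrite gt_eqF.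
have e0 := expR_gt0 (4 : R).
have h1 : ln N%:R `^ (- a) <= 2 * ln x `^ (- a).
  apply: le_trans (_ : (ln x / 2) `^ (- a) <= _); last by apply: powRN_half; lra.
  rewrite !powRN lef_pV2 ?posrE ?powR_gt0//; try lra.
  by apply: ge0_ler_powR => //; rewrite ?nnegrE; lra.
have p0 : 0 < ln x `^ (- a) by rewrite powR_gt0; lra.
have h2 : 1 <= x * ln x `^ (- a).
  rewrite -ler_pdivrMl// mulr1.
  apply: le_trans (inv_le_powRN _ (ltW a1)); last by lra.
  by rewrite lef_pV2 ?posrE//; [apply/ltW/ln_sublinear|lra].
have h3 : N%:R * ln N%:R `^ (- a) <= x * (2 * ln x `^ (- a)).
  by apply: ler_pM => //; exact: powR_ge0.
rewrite ler_pdivrMr//; move: xN; rewrite -natr1 => xN.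
have h4 := ler_wpM2l (_ : 0 <= 1 + 20 * expR 4) h3.
have {}h4 : (1 + 20 * expR 4) * (N%:R * ln N%:R `^ (- a)) <= (1 + 20 * expR 4) * (x * (2 * ln x `^ (- a))).
  by apply: h4; lra.
move: hc h4; rewrite -mulrA.
move: (_ * (N%:R * _)) => y hc h4.
apply: le_trans (_ : 1 * (x * ln x `^ (- a)) + 2 * ((1 + 20 * expR 4) * (x * (2 * ln x `^ (- a)))) <= _).
  lra.
by rewrite le_eqVlt; apply/orP; left; apply/eqP; ring.
Unshelve. all: by end_near. Qed.

Lemma notin_prodset_avoiding (k n : nat) : (0 < n)%N ->
  omega (llprimes (a * (w * scale k))) n = 0%N ->
  (omega (llprimes (w * scale k)) n)%:R <= 2 * (B * w * scale k) ->
  ln (n%:R : R) <= expR ((1 + eps) * scale k) ->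
  ~ prodset avoiding n.
Proof.
set s := scale k => n0 o1 o2 ln_ [x Ax [y Ay xyn]].
have big z : (0 < z)%N -> avoiding z -> (z %| n)%N -> B * w * s < (omega (llprimes (w * s)) z)%:R.
  move=> z0 Az zn.
  have zn' : ln (z%:R : R) <= ln n%:R.
    by rewrite ler_ln ?posrE ?ltr0n// ler_nat dvdn_leq.
  have lz0 : 0 <= ln (z%:R : R) by rewrite ln_ge0// ler1n.
  rewrite ltNge; apply/negP => oz; apply: Az.
  have [lz|lz] := leP (ln (z%:R : R)) (expR (w * s)); [left|right]; last first.
    by exists k; split => //; exact: le_trans zn' _.
  (* A prime factor of [z] with [ln p <= (ln z)^a <= exp(a w s)] would be a prime factor of [n]
     excluded by [o1]. *)
  move=> p ppr pz; rewrite ltNge; apply/negP => lp.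
  suff pQ : p \in llprimes (a * (w * s)).
    by have := omega_eq0 o1 pQ ppr n0; rewrite (dvdn_trans pz zn).
  rewrite mem_llprimes ppr/=; apply: le_trans lp _.
  by rewrite mulrC expRM; apply: ge0_ler_powR; rewrite ?nnegrE ?expR_ge0// ltW.
have := n0; rewrite -xyn muln_gt0 => /andP[x0 y0].
have xn : (x %| n)%N by rewrite -xyn dvdn_mulr.
have yn : (y %| n)%N by rewrite -xyn dvdn_mull.
have := big x x0 Ax xn; have := big y y0 Ay yn.
by move: o2; rewrite -xyn omegaM// natrD; lra.
Qed.

End construction.
End density.

(** * The complement of the product set *)

Section lower_bound.
Context {R : realType}.

(** A weak Stirling bound; the induction needs only [(x + 1) (ln (x + 1) - ln x) >= 1]. At [k = 0]
    it relies on [ln 0 = 0]. *)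
Lemma ln_fact_le (k : nat) : ln (k`!%:R : R) <= 1 + (k%:R + 1) * ln k%:R - k%:R.
Proof.
elim: k => [|[|k] IH]; first by rewrite fact0 ln1 ln0//; lra.
  by rewrite factS fact0 ln1; lra.
rewrite factS natrM lnM ?posrE ?ltr0n ?fact_gt0//.
have k0 : 0 < (k.+1%:R : R) by rewrite ltr0n.
move: IH; rewrite -[k.+2%:R]natr1; move: (ln (k.+1)`!%:R) (k.+1%:R : R) k0 => f x x0 IH.
have x1 : 0 < x + 1 by lra.
have h : 1 <= (x + 1) * (ln (x + 1) - ln x).
  have : ln (x / (x + 1)) <= x / (x + 1) - 1.
    have := @le_ln1Dx R (x / (x + 1) - 1); rewrite (_ : 1 + _ = x / (x + 1)); last by ring.
    by apply; have := divr_gt0 x0 x1; lra.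
  rewrite ln_div ?posrE// => /(ler_wpM2l (ltW x1)).
  have -> : (x + 1) * (x / (x + 1) - 1) = -1 by field; rewrite gt_eqF.
  lra.
lra.
Qed.

(** Poisson large deviations: [1 - phi beta = beta (1 - ln beta)]. Passing from [S] to [S0] costs
    18, rounding [k] costs [1 - ln beta], and Stirling costs [1 + ln S0]. *)
Lemma pow_fact_ge (S S0 beta : R) (k : nat) : 18 <= S0 -> S0 - 9 <= S -> 0 <= beta <= 1 ->
  k = Num.truncn (beta * S0) ->
  expR (S0 * (1 - phi beta) - (20 - ln beta) - ln S0) <= S ^+ k / k`!%:R.
Proof.
move=> S18 SS /andP[b0 b1] kE.
have S0p : 0 < S0 by lra.
have Sp : 0 < S by lra.
have kb : k%:R <= beta * S0 by rewrite kE truncn_le mulr_ge0// ltW.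
have bk : beta * S0 < k%:R + 1 by rewrite natr1 kE truncnS_gt.
have kS : k%:R <= S0 by apply: le_trans kb _; rewrite ler_piMl// ltW.
have fp : 0 < (k`!%:R : R) by rewrite ltr0n fact_gt0.
rewrite -[X in _ <= X]lnK ?posrE ?divr_gt0 ?exprn_gt0// ler_expR.
rewrite ln_div ?posrE ?exprn_gt0// lnXn// -[X in _ <= X - _]mulr_natl.
have := ln_fact_le k.
have lb : ln beta <= 0 by exact: ln_le0.
have lS0 : 0 <= ln S0 by apply: ln_ge0; lra.
have lk : ln (k%:R : R) <= ln S0.
  have [k0|k0] := posnP k; first by rewrite k0 ln0.
  by rewrite ler_ln ?posrE ?ltr0n.
have h1 : k%:R * (ln k%:R) <= k%:R * (ln beta + ln S0).
  have [k0|k0] := posnP k; first by rewrite k0 !mul0r.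
  rewrite ler_wpM2l//.
  have bp : 0 < beta.
    rewrite lt_neqAle b0 andbT; apply: contraTneq k0.
    by rewrite kE => <-; rewrite mul0r truncn0.
  by rewrite -lnM ?posrE// ler_ln ?posrE ?ltr0n ?mulr_gt0.
have h2 : k%:R * (ln S0 - ln S) <= 18.
  have : ln (S0 / S) <= S0 / S - 1.
    have := @le_ln1Dx R (S0 / S - 1); rewrite (_ : 1 + _ = S0 / S); last by ring.
    by apply; have := divr_gt0 S0p Sp; lra.
  rewrite ln_div ?posrE// => h.
  have {}h : ln S0 - ln S <= 9 / (S0 / 2).
    apply: le_trans h _; rewrite lerBlDr ler_pdivrMr//.
    have -> : (9 / (S0 / 2) + 1) * S = S + 18 / S0 * S by field; rewrite gt_eqF.
    suff : 9 <= 18 / S0 * S by lra.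
    have -> : 18 / S0 * S = (18 * S) / S0 by ring.
    by rewrite ler_pdivlMr//; lra.
  apply: le_trans (ler_wpM2l (ler0n _ k) h) _.
  have -> : k%:R * (9 / (S0 / 2)) = 18 * k%:R / S0 by field; rewrite gt_eqF.
  by rewrite ler_pdivrMr//; lra.
have h3 : (beta * S0 - 1) * (1 - ln beta) <= k%:R * (1 - ln beta).
  by rewrite ler_wpM2r//; lra.
move: h1 h2 h3; rewrite phiE.
move: (k%:R) lk => x lk h1 h2 h3 h4.
have : ln S0 * x = x * ln S0 by ring.
lra.
Qed.

(** Concavity of [ln]: [ln y <= y - 1] is applied at [u / v] and [1 / v] with weights [c] and
    [1 - c]; the right-hand sides cancel since [v] is the weighted mean of [u] and 1. *)
Lemma powR_bernoulli (c u : R) : 0 <= c <= 1 -> 0 < u -> u `^ c <= 1 + c * (u - 1).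
Proof.
move=> /andP[c0 c1] u0; set v := 1 + _.
have v0 : 0 < v by rewrite /v; nra.
have lnb (y : R) : 0 < y -> ln (y / v) <= y / v - 1.
  move=> y0; have := @le_ln1Dx R (y / v - 1); rewrite (_ : 1 + _ = y / v); last by ring.
  by apply; have := divr_gt0 y0 v0; lra.
rewrite /powR gt_eqF// -[X in _ <= X](lnK v0) ler_expR.
have := ler_wpM2l c0 (lnb _ u0).
have := ler_wpM2l (_ : 0 <= 1 - c) (lnb _ ltr01).
rewrite subr_ge0 => /(_ c1).
rewrite !ln_div ?posrE// ln1 => h1 h2.
have E : c * (u / v - 1) + (1 - c) * (1 / v - 1) = 0.
  by rewrite /v; field; rewrite gt_eqF.
lra.
Qed.

(** Integral comparison for [x^-b] on [[J, J + 1]], through Bernoulli at [J / (J + 1)]; it makes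
    sums of [J^-b] telescope. *)
Lemma powRN_le_diff (b : R) (J : nat) : 0 < b < 1 ->
  (1 - b) * J.+1%:R `^ (- b) <= J.+1%:R `^ (1 - b) - J%:R `^ (1 - b).
Proof.
move=> /andP[b0 b1]; set y : R := J.+1%:R; have y0 : 0 < y by rewrite ltr0n.
have E : y `^ (1 - b) = y * y `^ (- b).
  by rewrite powRD ?powRr1 ?(ltW y0)//; apply/implyP => _; rewrite gt_eqF.
have p0 : 0 < y `^ (- b) by rewrite powR_gt0.
have [J0|J0] := posnP J.
  have b1' : 1 - b != 0 by rewrite subr_eq0 gt_eqF.
  rewrite J0 (powR0 b1') subr0 E ler_pM2r//.
  by rewrite /y J0; lra.
have x0 : 0 < (J%:R : R) by rewrite ltr0n.
have := @powR_bernoulli (1 - b) (J%:R / y) _ (divr_gt0 x0 y0).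
rewrite subr_ge0 (ltW b1) => /(_ _)/=; rewrite gerBl (ltW b0) => /(_ isT).
move=> /(ler_wpM2r (powR_ge0 y (1 - b))).
rewrite -powRM ?(ltW y0) ?(ltW (divr_gt0 x0 y0))// divfK ?gt_eqF// => h.
have {}h : J%:R `^ (1 - b) <= (1 + (1 - b) * (J%:R / y - 1)) * (y * y `^ (- b)) by rewrite -E.
have yJ : J%:R = y - 1 by rewrite /y -natr1 addrK.
have {}h : J%:R `^ (1 - b) <= (y - (1 - b)) * y `^ (- b).
  rewrite (_ : (y - (1 - b)) * _ = (1 + (1 - b) * (J%:R / y - 1)) * (y * y `^ (- b)))//.
  by rewrite yJ; field; rewrite gt_eqF.
rewrite E; move: (J%:R `^ _) h => z h; clearbody y.
by rewrite mulrBl in h; lra.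
Qed.

(** Summation over the blocks [exp J < n <= exp(J + 1)]: each has at most [C exp(J + 1) (J + 1)^-b]
    elements outside [P], weighted by at most [exp(- J)]. *)
Lemma harmonic_compl_le (P : set nat) (b : R) : 0 < b < 1 -> compl_ll P b ->
  exists2 C : R, 0 < C & forall J, (0 < J)%N ->
    \sum_(1 <= n < (Num.truncn (expR J%:R : R)).+1) `[< ~ P n >]%:R / n%:R <= C * J%:R `^ (1 - b).
Proof.
move=> b01 [C0 [x0 [_ hx]]]; have /andP[b0 b1] := b01.
pose Nn J := Num.truncn (expR J%:R : R).
pose H J : R := \sum_(1 <= n < (Nn J).+1) `[< ~ P n >]%:R / n%:R.
have t0 n : 0 <= `[< ~ P n >]%:R / (n%:R : R) by rewrite divr_ge0.
have NnS J : (Nn J <= Nn J.+1)%N.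
  by rewrite /Nn truncn_ge_nat ?expR_ge0// (le_trans (_ : _ <= expR J%:R))
    ?truncn_le ?expR_ge0// ler_expR ler_nat.
have HS J : H J.+1 = H J + \sum_((Nn J).+1 <= n < (Nn J.+1).+1) `[< ~ P n >]%:R / n%:R.
  by rewrite /H (big_cat_nat _ (n := (Nn J).+1))//= ltnS.
have Hm J J' : (J <= J')%N -> H J <= H J'.
  elim: J' => [|J' IH]; first by rewrite leqn0 => /eqP ->.
  rewrite leq_eqVlt => /predU1P[->//|/IH h]; apply: le_trans h _.
  by rewrite HS lerDl sumr_ge0.
pose J0 := (Num.truncn x0).+1.
have step J : (J0 <= J)%N -> H J.+1 - H J <= `|C0| * expR 1 * J.+1%:R `^ (- b).
  move=> J0J; rewrite HS addrAC subrr add0r.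
  have hJ : x0 < expR J.+1%:R.
    apply: lt_le_trans (truncnS_gt x0) _; apply: le_trans (_ : J.+1%:R <= _).
      by rewrite ler_nat (leq_trans J0J).
    by have := expR_ge1Dx (J.+1%:R : R); lra.
  have := hx _ hJ; rewrite /rel_compl count_uptoE ?expR_ge0// -/(Nn J.+1) expRK.
  have e0 := expR_gt0 (J.+1%:R : R).
  have Ne : (Nn J.+1)%:R <= expR (J.+1%:R : R) by rewrite truncn_le expR_ge0.
  have cE : (cnt P (Nn J.+1))%:R = (Nn J.+1)%:R - (cnt (~` P) (Nn J.+1))%:R :> R.
    by rewrite -[in X in X - _](cntC P (Nn J.+1)) natrD addrK.
  move=> /(le_trans (ler_norm _)); rewrite cE => h.
  have {}h : (cnt (~` P) (Nn J.+1))%:R <= expR J.+1%:R * (`|C0| * J.+1%:R `^ (- b)).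
    have {}h : 1 - ((Nn J.+1)%:R - (cnt (~` P) (Nn J.+1))%:R) / expR J.+1%:R <= `|C0| * J.+1%:R `^ (- b).
      by apply: le_trans h _; rewrite ler_wpM2r ?powR_ge0// ler_norm.
    have := ler_wpM2l (ltW e0) h; rewrite mulrBr mulr1 mulrCA divff ?gt_eqF//; lra.
  apply: (@le_trans _ _ (expR (- J%:R) * (cnt (~` P) (Nn J.+1))%:R)); last first.
    apply: le_trans (ler_wpM2l (expR_ge0 _) h) _.
    rewrite mulrA -expRD -natr1 (_ : - J%:R + _ = 1); last by ring.
    by rewrite mulrCA mulrA.
  rewrite /cnt natr_sum mulr_sumr [X in _ <= X](big_cat_nat _ (n := (Nn J).+1))//=; last first.
    exact: NnS.
  apply: ler_wpDl; first by apply: sumr_ge0 => n _; rewrite mulr_ge0 ?expR_ge0.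
  rewrite [X in X <= _]big_nat_cond [X in _ <= X]big_nat_cond.
  apply: ler_sum => n /andP[/andP[n1 n2] _].
  rewrite mulrC ler_wpM2r// expRN lef_pV2 ?posrE ?expR_gt0 ?ltr0n//; last by lia.
  by rewrite ltW// (lt_le_trans (truncnS_gt _))// ler_nat.
pose C2 := `|C0| * expR 1 / (1 - b).
have C20 : 0 <= C2 by rewrite divr_ge0 ?mulr_ge0 ?expR_ge0// subr_ge0 ltW.
have H0 J : 0 <= H J by exact: sumr_ge0.
have main J : H J <= H J0 + C2 * J%:R `^ (1 - b).
  elim: J => [|J IH].
    by apply: ler_wpDr; [rewrite mulr_ge0 ?powR_ge0|exact: Hm].
  have [JJ|JJ] := leqP J0 J; last first.
    by apply: ler_wpDr; [rewrite mulr_ge0 ?powR_ge0|exact: Hm].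
  have := step _ JJ.
  have := ler_wpM2l C20 (powRN_le_diff J b01).
  have -> : C2 * ((1 - b) * J.+1%:R `^ (- b)) = `|C0| * expR 1 * J.+1%:R `^ (- b).
    by rewrite /C2; field; rewrite gt_eqF// subr_gt0.
  by rewrite mulrBr; lra.
(* The initial blocks [H J0] are absorbed by [J^(1 - b) >= 1]; the summand 1 only makes the constant
   positive. *)
exists (1 + H J0 + C2); first by have := H0 J0; lra.
move=> J Jp; apply: le_trans (main J) _.
have : 1 <= (J%:R : R) `^ (1 - b).
  rewrite -[X in X <= _](powRr0 (J%:R : R)) ler_powR ?ler1n//; lra.
have := H0 J0; move: (_ `^ _) (H J0) => y h h0 y1; nra.
Qed.

(** Half of the exponent [1 / L] produces the decay, the other half keeps the series convergent with
    sum at most [1 + 2 L]. *)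
Lemma dterm_tail (L : R) (J K : nat) : 0 < L ->
  \sum_((Num.truncn (expR J%:R : R)).+1 <= n < K) dterm L^-1 n <=
  (1 + 2 * L) * expR (- (J%:R / (2 * L))).
Proof.
move=> L0; have d0 : 0 < (2 * L)^-1 by rewrite invr_gt0 mulr_gt0.
apply: (@le_trans _ _ (\sum_((Num.truncn (expR J%:R : R)).+1 <= n < K)
    dterm (2 * L)^-1 n * expR (- (J%:R / (2 * L))))).
  rewrite [X in X <= _]big_nat_cond [X in _ <= X]big_nat_cond.
  apply: ler_sum => n /andP[/andP[n1 n2] _].
  have n0 : (0 < n)%N by lia.
  have lnJ : J%:R <= ln (n%:R : R).
    rewrite -[X in X <= _]expRK ler_ln ?posrE ?expR_gt0 ?ltr0n//.
    by rewrite ltW// (lt_le_trans (truncnS_gt _))// ler_nat.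
  rewrite !dtermE// -mulrA ler_wpM2l ?invr_ge0// -expRD ler_expR.
  have -> : - L^-1 * ln (n%:R : R) = - (2 * L)^-1 * ln n%:R - ln n%:R / (2 * L).
    by field; rewrite gt_eqF.
  by rewrite lerD2l lerN2 ler_wpM2r// ltW.
rewrite -mulr_suml ler_wpM2r ?expR_ge0//.
have := sum_dterm_le K d0; rewrite invrK => h.
have [h'|h'] := leqP K (Num.truncn (expR J%:R : R)).+1.
  by rewrite big_geq//; lra.
apply: le_trans h; rewrite [X in _ <= X](big_cat_nat _ (n := (Num.truncn (expR J%:R : R)).+1)) ?(ltnW h')//=.
by rewrite lerDr sumr_ge0// => n _; exact: dterm_ge0.
Qed.

End lower_bound.

Section psi_bound.
Context {R : realType}.

Lemma dsum_dterm_ge (L : R) : 1 <= L -> L / 2 <= dsum (dterm L^-1).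
Proof.
move=> L1; have L0 : 0 < L by lra.
have d0 : 0 < L^-1 by rewrite invr_gt0.
have -> : L / 2 = (2 * L^-1)^-1 by rewrite invfM invrK mulrC.
apply: le_trans (sum_dterm_ge (N := Num.truncn (expR L)) d0 _) _.
  by rewrite ler_pdivlMl// mulr1 ln_truncnS_expR.
by rewrite -sum_nat1 ?dterm0//; apply: le_dsum; exact: summable_dterm.
Qed.

(** The decay [exp(- exp(eps s) / 2)] beats [exp(s)] uniformly in [s]: use [exp y >= y^2 / 2] and
    complete the square in [s - (eps s)^2 / 4]. *)
Lemma tail_bound (eps s : R) (J : nat) : 0 < eps -> 0 <= s ->
  J = Num.truncn (expR ((1 + eps) * s)) ->
  (1 + 2 * expR s) * expR (- (J%:R / (2 * expR s))) <= 3 * expR (1 + (eps ^+ 2)^-1).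
Proof.
move=> e0 s0 JE; set L := expR s; have L0 : 0 < L := expR_gt0 s.
have L1 : 1 <= L by rewrite /L -expR0 ler_expR.
have hJ : expR (eps * s) / 2 - 1 <= J%:R / (2 * L).
  have h : expR ((1 + eps) * s) - 1 <= J%:R.
    by rewrite lerBlDr natr1 JE ltW// truncnS_gt.
  have : (expR ((1 + eps) * s) - 1) / (2 * L) <= J%:R / (2 * L).
    by rewrite ler_pM2r// invr_gt0 mulr_gt0.
  apply: le_trans.
  rewrite (_ : (1 + eps) * s = s + eps * s) ?expRD -/L; last by ring.
  have -> : (L * expR (eps * s) - 1) / (2 * L) = expR (eps * s) / 2 - (2 * L)^-1.
    by field; rewrite gt_eqF.
  rewrite lerD2l lerN2 invf_le1 ?mulr_gt0//; lra.
have hq : (eps * s) ^+ 2 / 2 <= expR (eps * s).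
  have es : 0 <= eps * s by rewrite mulr_ge0// ltW.
  by have := expR_ge1Dxn 1 es; rewrite (_ : 2`! = 2)%N//; lra.
have hs : s - (eps * s) ^+ 2 / 4 <= (eps ^+ 2)^-1.
  rewrite -subr_ge0.
  have -> : (eps ^+ 2)^-1 - (s - (eps * s) ^+ 2 / 4) = (eps^-1 - eps * s / 2) ^+ 2.
    by field; rewrite gt_eqF.
  exact: sqr_ge0.
apply: le_trans (_ : 3 * L * expR (- (J%:R / (2 * L))) <= _).
  by rewrite ler_wpM2r ?expR_ge0//; lra.
by rewrite -mulrA ler_wpM2l// -expRD ler_expR; lra.
Qed.

Section contradiction.
Variables (a w eps B b : R) (M : nat).
Hypotheses (a0 : 0 < a) (a1 : a < 1) (w0 : 0 < w) (w1 : w < 1) (eps0 : 0 < eps).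
Hypotheses (B01 : 0 <= B <= 1) (b01 : 0 < b < 1).
(** The number of primes aimed at, as a fraction of the Poisson mean. Structure permits the fraction
    [2 B]; above 1 nothing is gained, a count near the mean being typical ([phi 1 = 0]). *)
Let beta : R := Num.min 1 (2 * B).

Let beta01 : 0 <= beta <= 1.
Proof.
by have /andP[B0 _] := B01; rewrite /beta ge_min lexx le_min ler01 mulr_ge0.
Qed.

(** Three factors: [exp(s - 1)] from the full series, [exp(- w s - 8)] from the Euler product, and
    the Poisson term. Its parameter is at least [(w s - 3) - (a w s + 6)], whence the 9 in
    [pow_fact_ge]; and [29 = 20 + 1 + 8]. *)
Lemma dsum_structured_ge (s : R) (k : nat) : 0 <= s -> 18 <= (1 - a) * (w * s) ->
  k = Num.truncn (beta * ((1 - a) * (w * s))) ->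
  expR ((1 - w + (1 - a) * w * (1 - phi beta)) * s - (29 - ln beta) -
        ln ((1 - a) * (w * s))) <=
  dsum (fun n => ((omega (llprimes (a * (w * s))) n == 0%N) &&
                  (omega (llprimes (w * s)) n == k))%:R * dterm (expR s)^-1 n).
Proof.
have [[a0' a1'] [w0' w1']] := ((a0, a1), (w0, w1)) => s0 S18 kE.
set Q := llprimes (a * (w * s)); set Z := llprimes (w * s).
set L := expR s; set t := dterm L^-1.
have L0 : 0 < L := expR_gt0 s.
have L1 : 1 <= L by rewrite /L -expR0 ler_expR.
have d0 : 0 < L^-1 by rewrite invr_gt0.
have ws0 : 0 <= w * s by rewrite mulr_ge0// ltW.
have aws0 : 0 <= a * (w * s) by rewrite mulr_ge0// ltW.
have QZ : {subset Q <= Z}.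
  move=> p; rewrite !mem_llprimes => /andP[-> h]/=; apply: le_trans h _.
  by rewrite ler_expR ler_piMl// ltW.
pose P := [seq p <- Z | p \notin Q].
have uZ : uniq Z := primes_upto_uniq _.
have uQ : uniq Q := primes_upto_uniq _.
have uQP : uniq (Q ++ P).
  rewrite cat_uniq uQ filter_uniq// andbT/=; apply/hasPn => p.
  by rewrite mem_filter => /andP[].
have perm : perm_eq (Q ++ P) Z.
  apply: uniq_perm => // p; rewrite mem_cat [p \in P]mem_filter.
  by case: (boolP (p \in Q)) => [/QZ h|_] /=; rewrite ?h.
have prQP : all prime (Q ++ P) by rewrite (perm_all _ perm) all_primes_upto.
have := dsum_omega_eq d0 k prQP uQP; rewrite -/t (perm_big _ perm)/=.
set S := \sum_(p <- P) t p.
have ZQ : \sum_(p <- Z) t p = \sum_(p <- Q) t p + S by rewrite -(perm_big _ perm) big_cat.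
have tinv N : \sum_(p <- primes_upto N) t p <= \sum_(p <- primes_upto N) (p%:R : R)^-1.
  rewrite big_seq [X in _ <= X]big_seq; apply: ler_sum => p.
  by rewrite mem_primes_upto => /andP[ppr _]; rewrite dterm_le_inv ?(ltW d0)// prime_gt0.
have e1 (r : R) : 0 <= r -> 1 <= expR r by move=> r0; rewrite -expR0 ler_expR.
have Qle : \sum_(p <- Q) t p <= a * (w * s) + 6.
  apply: le_trans (tinv _) _.
  by apply: le_trans (sum_prime_inv_le (e1 _ aws0)) _; rewrite expRK.
have Zle : \sum_(p <- Z) t p <= w * s + 6.
  apply: le_trans (tinv _) _.
  by apply: le_trans (sum_prime_inv_le (e1 _ ws0)) _; rewrite expRK.
have Zge : w * s - 3 <= \sum_(p <- Z) t p.
  rewrite -[in X in X - _ <= _](expRK (w * s)); apply: sum_prime_dterm_ge; first exact: e1.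
  rewrite (ltW d0)/= lef_pV2 ?posrE ?expR_gt0// ler_expR ler_piMl// ltW//.
have SS : (1 - a) * (w * s) - 9 <= S by lra.
have := pow_fact_ge S18 SS beta01 kE.
have := prod_dterm_ge (Num.truncn (expR (expR (w * s)))) (ltW d0).
rewrite -/(llprimes (w * s)) -/Z -/t.
set Pi := \prod_(p <- Z) _; set F := S ^+ k / _ => hPi hF.
have {}hPi : expR (- (w * s) - 8) <= Pi by apply: le_trans hPi; rewrite ler_expR; lra.
have hZ : expR (s - 1) <= dsum t.
  apply: le_trans (dsum_dterm_ge L1); rewrite expRB ler_pM2l//.
  by rewrite lef_pV2 ?posrE ?expR_gt0//; have := expR_ge1Dx (1 : R); lra.
move=> h.
have {}h : F * (dsum t * Pi) <= dsum (fun n => ((omega Q n == 0%N) && (omega Z n == k))%:R * t n).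
  apply: le_trans h _; rewrite le_eqVlt; apply/orP; left; apply/eqP.
  apply: eq_dsum => n; congr ((nat_of_bool _)%:R * _); case: eqP => //= oQ.
  have -> : omega Z n = omega (Q ++ P) n by rewrite /omega (perm_big _ perm).
  by rewrite omega_cat oQ.
apply: le_trans h; apply: le_trans (_ : expR ((1 - a) * (w * s) * (1 - phi beta) -
    (20 - ln beta) - ln ((1 - a) * (w * s))) * (expR (s - 1) * expR (- (w * s) - 8)) <= _).
  rewrite -!expRD ler_expR le_eqVlt; apply/orP; left; apply/eqP; ring.
by apply: ler_pM; rewrite ?mulr_ge0 ?expR_ge0//; apply: ler_pM; rewrite ?expR_ge0.
Qed.

Hypothesis wB : phi B * w = (1 + eps) * a.
Hypothesis M1 : (1 < M)%N.
Hypothesis scaleS : forall k, (2 + eps) * scale M k <= w * scale M k.+1 :> R.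
(** On the left, the growth in [s] allowed to the harmonic sum of the complement; on the right, that
    of the structured integers, rewritten from [1 - w + (1 - a) w (1 - phi beta)]. *)
Hypothesis kappa : (1 + eps) * (1 - b) < 1 - w * (a + (1 - a) * phi beta).

Lemma prodset_avoiding_not_ll : ~ compl_ll (prodset (avoiding a w eps B M)) b.
Proof.
have [[a0' a1'] [w0' w1']] := ((a0, a1), (w0, w1)).
have [eps0' kappa'] := (eps0, kappa); have /andP[b0 b1] := b01.
move=> /(harmonic_compl_le b01)[C C0 HC].
pose c := 1 - w * (a + (1 - a) * phi beta) - (1 + eps) * (1 - b).
have c0 : 0 < c by rewrite /c; lra.
pose D := C + 3 * expR (1 + (eps ^+ 2)^-1).
have D0 : 0 < D by rewrite addr_gt0// mulr_gt0// expR_gt0.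
(* Comparing the two bounds for the structured series, their exponents differ by [c s] while all
   other terms are [O(ln s)]. *)
have key k : 18 <= (1 - a) * (w * scale M k) -> c * scale M k <= 29 - ln beta + ln (scale M k : R) + ln D.
  set s : R := scale M k => S18.
  have s1 : 1 <= s by exact: scale_ge1 (ltnW M1) k.
  have s0 : 0 <= s by lra.
  pose k2 := Num.truncn (beta * ((1 - a) * (w * s))).
  have := dsum_structured_ge s0 S18 (erefl k2); set g := fun n => _ => h.
  pose J := Num.truncn (expR ((1 + eps) * s)).
  have sg : summable g.
    apply: summable_dtermM => [|n]; first by rewrite invr_gt0 expR_gt0.
    by rewrite ler0n lern1 leq_b1.
  have e1 : 1 <= expR ((1 + eps) * s) by rewrite -[X in X <= _]expR0 ler_expR mulr_ge0//; lra.
  have J0 : (0 < J)%N by rewrite truncn_gt0.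
  have Je : J%:R <= expR ((1 + eps) * s) by rewrite truncn_le expR_ge0.
  have k2B : k2%:R <= 2 * (B * w * s).
    have S0 : 0 <= (1 - a) * (w * s) by lra.
    apply: le_trans (_ : beta * ((1 - a) * (w * s)) <= _).
      by rewrite truncn_le mulr_ge0//; have /andP[] := beta01.
    apply: le_trans (_ : 2 * B * (w * s) <= _); last by rewrite !mulrA.
    have ws0 : 0 <= w * s by rewrite mulr_ge0// ltW.
    apply: ler_pM => //; first by have /andP[] := beta01.
      by rewrite /beta ge_min lexx orbT.
    by rewrite ler_piMl//; lra.
  have up : dsum g <= C * J%:R `^ (1 - b) + 3 * expR (1 + (eps ^+ 2)^-1).
    apply: dsum_le => // K; set N := Num.truncn (expR J%:R : R).
    have g0 n : 0 <= g n by exact: (proj1 sg).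
    apply: (@le_trans _ _ (\sum_(0 <= n < N.+1) g n + \sum_(N.+1 <= n < K) g n)).
      have [KN|NK] := leqP K N.+1.
        rewrite [X in _ <= _ + X]big_geq// addr0 [X in _ <= X](big_cat_nat _ (n := K))//=.
        by rewrite lerDl sumr_ge0.
      by rewrite -(big_cat_nat _ (n := N.+1)) ?(ltnW NK).
    apply: lerD; last first.
      apply: le_trans (tail_bound eps0 s0 (erefl J)).
      apply: le_trans (dterm_tail J K (expR_gt0 s)).
      by apply: ler_sum => n _; rewrite ler_piMl ?dterm_ge0// lern1 leq_b1.
    apply: le_trans (HC J J0).
    have g00 : g 0%N = 0 by rewrite /g dterm0 ?mulr0// invr_gt0 expR_gt0.
    rewrite sum_nat1// [X in X <= _]big_nat_cond [X in _ <= X]big_nat_cond.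
    apply: ler_sum => n /andP[/andP[n0 nN] _]; rewrite /g.
    case: (boolP (_ && _)) => [/andP[/eqP oQ /eqP oZ]|_]; last by rewrite mul0r divr_ge0.
    have lnn : ln (n%:R : R) <= expR ((1 + eps) * s).
      apply: le_trans Je; rewrite -[X in _ <= X]expRK ler_ln ?posrE ?expR_gt0 ?ltr0n//.
      by rewrite -truncn_ge_nat ?expR_ge0.
    have nA : ~ prodset (avoiding a w eps B M) n.
      by apply: (@notin_prodset_avoiding R a w eps B M a0 k n n0) => //; rewrite oZ.
    by rewrite asboolT// !mul1r dterm_le_inv// invr_ge0 expR_ge0.
  have JJ : J%:R `^ (1 - b) <= expR ((1 + eps) * s * (1 - b)).
    rewrite expRM; apply: ge0_ler_powR; rewrite ?nnegrE ?expR_ge0//; lra.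
  have {}up : dsum g <= D * expR ((1 + eps) * s * (1 - b)).
    apply: le_trans up _; rewrite /D [X in _ <= X]mulrDl lerD//.
      by rewrite ler_wpM2l// ltW.
    rewrite ler_peMr ?mulr_ge0 ?expR_ge0// -[X in X <= _]expR0 ler_expR.
    by rewrite !mulr_ge0//; lra.
  have hh := le_trans h up; rewrite -[X in _ <= X * _](lnK D0) -expRD ler_expR in hh.
  have lS : ln ((1 - a) * (w * s)) <= ln s.
    rewrite ler_ln ?posrE; [|lra|lra].
    rewrite mulrA ler_piMl//; by have := mulr_gt0 a0' w0'; lra.
  by rewrite /c; lra.
have lns (s : R) : 0 < s -> ln s <= c / 2 * s - ln (c / 2).
  move=> s0; have c20 : 0 < c / 2 by lra.
  have := ln_sublinear (mulr_gt0 c20 s0); rewrite lnM ?posrE//; lra.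
(* The first entry ensures the requirement 18 of [key]. The second contradicts [key] once [ln s] is
   replaced by [(c / 2) s - ln (c / 2)]; 30 instead of 29 makes this strict. *)
pose X := Num.max (18 / ((1 - a) * w)) ((30 - ln beta - ln (c / 2) + ln D) / (c / 2)).
have Mk (k : nat) : k%:R <= scale M k :> R by rewrite ler_nat ltnW// ltn_expl.
have [k Xk] : exists k, X <= scale M k.
  exists (Num.truncn X).+1; apply: le_trans (Mk _); rewrite ltW// truncnS_gt//.
have S18 : 18 <= (1 - a) * (w * scale M k).
  have : 18 / ((1 - a) * w) <= scale M k by apply: le_trans Xk; rewrite /X le_max lexx.
  by rewrite ler_pdivrMr ?mulr_gt0 ?subr_gt0// mulrC mulrA.
have : (30 - ln beta - ln (c / 2) + ln D) / (c / 2) <= scale M k.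
  by apply: le_trans Xk; rewrite /X le_max lexx orbT.
have s0 : 0 < scale M k :> R by rewrite ltr0n expn_gt0 (ltnW M1).
have := key _ S18; have := lns _ s0.
move: (scale M k : R) => s h1 h2; rewrite ler_pdivrMr; last by lra.
lra.
Qed.

End contradiction.

Lemma compl_ll_le (P : set nat) (b b' : R) : b' <= b -> compl_ll P b -> compl_ll P b'.
Proof.
move=> bb' [C hC]; exists `|C|; near=> x.
have x1 : expR 1 <= x by near: x; exact: nbhs_pinfty_ge.
have lx : 1 <= ln x.
  by rewrite -[X in X <= _]expRK ler_ln ?posrE ?expR_gt0// (lt_le_trans (expR_gt0 1)).
have h : `|rel_compl P x| <= C * ln x `^ (- b) by near: x.
apply: le_trans h _; apply: le_trans (_ : `|C| * ln x `^ (- b) <= _).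
  by rewrite ler_wpM2r ?powR_ge0// ler_norm.
by rewrite ler_wpM2l// ler_powR// lerN2.
Unshelve. all: by end_near. Qed.

Lemma phi_ge0_le1 (x : R) : 0 <= x <= 1 -> 0 <= phi x <= 1.
Proof.
move=> x01; have [h _ _] := @phi_bij R.
by have := h x; rewrite /= !in_itv/=; apply.
Qed.

Lemma psi_le_W (a B : R) : 0 < a < 1 / 4 -> B \in `[0, phi_inv (4 * a)] ->
  (psi a <= (W a B)%:E)%E.
Proof.
move=> /andP[a0 a4] BI.
have I4a : 4 * a \in `[0, 1] by rewrite in_itv/=; lra.
have := phi_inv_itv I4a; rewrite in_itv/= => /andP[q0 q1].
move: BI; rewrite in_itv/= => /andP[B0 Bq].
have B1 : B <= 1 by exact: le_trans Bq q1.
have phi4 : 4 * a <= phi B.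
  by rewrite -(phi_invK I4a) (le_nmono_in (@phi_decr R))// in_itv/= ?q0 ?B0.
have f0 : 0 < phi B by lra.
set beta := Num.min 1 (2 * B).
have beta01 : 0 <= beta <= 1 by rewrite /beta ge_min lexx le_min ler01 mulr_ge0.
have /andP[f20 f21] := phi_ge0_le1 beta01.
pose u := a / phi B.
have u0 : 0 < u by rewrite divr_gt0.
have u4 : u <= 1 / 4 by rewrite ler_pdivrMr//; lra.
have uf : phi B * u = a by rewrite /u mulrC divfK// gt_eqF.
pose c0 := u * (a + (1 - a) * phi beta).
(* From [sqrt(f^2 - 4 a f) <= f - 2 a] the first term of [W] is at least [a^2 / f = a u]; the term
   [- a u phi(beta)] of [c0] is discarded. *)
have c0W : c0 <= W a B.
  rewrite /W -/beta.
  have -> : a * (phi beta / phi B) = u * phi beta by rewrite /u; ring.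
  suff h : a * u <= (phi B - Num.sqrt (phi B ^+ 2 - 4 * a * phi B)) ^+ 2 / (4 * phi B).
    apply: le_trans (lerD h (lexx _)); rewrite /c0.
    have := mulr_ge0 (ltW a0) (mulr_ge0 (ltW u0) f20); lra.
  set q := Num.sqrt _.
  have qle : q <= phi B - 2 * a.
    have -> : phi B - 2 * a = Num.sqrt ((phi B - 2 * a) ^+ 2).
      by rewrite sqrtr_sqr ger0_norm//; lra.
    rewrite /q; apply: ler_wsqrtr; rewrite -subr_ge0.
    rewrite (_ : _ - _ = (2 * a) ^+ 2) ?sqr_ge0//; ring.
  rewrite ler_pdivlMr ?mulr_gt0//.
  have -> : a * u * (4 * phi B) = (2 * a) ^+ 2 by rewrite -[in RHS]uf /u; field; rewrite gt_eqF.
  by rewrite ler_sqr ?nnegrE; lra.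
have c04 : c0 <= 1 / 4.
  have : a + (1 - a) * phi beta <= 1 by nra.
  have : 0 <= a + (1 - a) * phi beta by nra.
  by rewrite /c0; move: (a + _) => y y0 y1; nra.
have c00 : 0 <= c0 by rewrite /c0 mulr_ge0 ?(ltW u0)// addr_ge0 ?(ltW a0)// mulr_ge0//; lra.
apply: ge_ereal_sup => _ [b0 [b00 hb] <-]; rewrite lee_fin leNgt; apply/negP => Wb.
(* The harmonic sum bound requires an exponent below 1; [c0 <= 1 / 4] keeps the lowered [b] above
   [c0]. *)
pose b := Num.min b0 (3 / 4).
have bb0 : b <= b0 by rewrite /b ge_min lexx.
have b34 : b <= 3 / 4 by rewrite /b ge_min lexx orbT.
have cb : c0 < b by rewrite /b lt_min (le_lt_trans c0W Wb)/=; lra.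
(* With this choice [(1 + eps) (1 - b) = 1 - (1 + eps) c0 - eps^2], so [kappa] holds with margin
   [eps^2]. *)
pose eps := b - c0; have e0 : 0 < eps by rewrite subr_gt0.
pose w := (1 + eps) * u.
have e1 : eps <= 3 / 4 by rewrite /eps; lra.
have w0 : 0 < w by rewrite mulr_gt0//; lra.
have w1 : w < 1 by rewrite /w; nra.
pose M := (Num.truncn ((2 + eps) / w)).+2.
have wM : 2 + eps <= w * M%:R.
  rewrite -ler_pdivrMl// mulrC; apply: le_trans (ltW (truncnS_gt _)) _.
  by rewrite ler_nat.
have scaleS k : (2 + eps) * scale M k <= w * scale M k.+1 :> R.
  by rewrite /scale expnS natrM mulrA ler_wpM2r.
have B01 : 0 <= B <= 1 by rewrite B0.
have a1 : a < 1 by lra.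
have wB : phi B * w = (1 + eps) * a by rewrite /w mulrCA uf.
have b01 : 0 < b < 1 by apply/andP; split; lra.
have kap : (1 + eps) * (1 - b) < 1 - w * (a + (1 - a) * phi beta).
  have -> : w * (a + (1 - a) * phi beta) = (1 + eps) * c0 by rewrite /w /c0; ring.
  have -> : (1 + eps) * (1 - b) = (1 + eps) * (1 - c0 - eps) by rewrite /eps; ring.
  have := mulr_gt0 e0 e0; lra.
apply: (@prodset_avoiding_not_ll a w eps B b M) => //.
apply: (compl_ll_le bb0); apply: hb.
exact: (@avoiding_compl_ll R a w eps B M).
Qed.

End psi_bound.

(** * The inequality K(a) < a and the behaviour of K near 0 *)

Section numerics.
Context {R : realType}.

Lemma lerX_nneg (n : nat) (x y : R) : 0 <= x -> x <= y -> x ^+ n <= y ^+ n.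
Proof. by move=> x0 xy; apply: lerXn2r; rewrite ?nnegrE// (le_trans x0). Qed.

Lemma expR_ge_series (y : R) (n : nat) : 0 <= y ->
  \sum_(0 <= k < n) y ^+ k / k`!%:R <= expR y.
Proof.
move=> y0; apply: (@nondecreasing_cvgn_le R (series (exp_coeff y))).
  by apply: nondecreasing_series => k _ _; rewrite /exp_coeff/= mulr_ge0 ?exprn_ge0.
exact: is_cvg_series_exp_coeff.
Qed.

(** For [y <= 1 / 2] the terms from [n] on are dominated by a geometric series of ratio [1 / 2]. *)
Lemma expR_le_series (y : R) (n : nat) : 0 <= y <= 1 / 2 ->
  expR y <= \sum_(0 <= k < n) y ^+ k / k`!%:R + 2 * (y ^+ n / n`!%:R).
Proof.
move=> /andP[y0 y1]; set c := y ^+ n / _; set P := \sum_(0 <= k < n) _.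
have c0 : 0 <= c by rewrite divr_ge0 ?exprn_ge0.
have term m : y ^+ (n + m) / (n + m)`!%:R <= c * 2^-1 ^+ m.
  rewrite exprD /c -mulrA [X in _ <= X]mulrAC -[X in _ <= X]mulrA ler_wpM2l ?exprn_ge0//.
  apply: ler_pM; rewrite ?exprn_ge0 ?invr_ge0//.
    by apply: lerX_nneg => //; lra.
  by rewrite lef_pV2 ?posrE ?ltr0n ?fact_gt0// ler_nat leq_fact// leq_addr.
have part m : \sum_(0 <= k < n + m) y ^+ k / k`!%:R <= P + (2 - 2 * 2^-1 ^+ m) * c.
  elim: m => [|m IH]; first by rewrite addn0 expr0 -/P; lra.
  rewrite addnS big_nat_recr//=; apply: le_trans (lerD IH (term m)) _.
  by rewrite exprS; move: (_ ^+ m) => z; lra.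
apply: limr_le; first exact: is_cvg_series_exp_coeff.
near=> N; have nN : (n <= N)%N by near: N; exact: nbhs_infty_ge.
apply: (@le_trans _ _ (\sum_(0 <= k < N) y ^+ k / k`!%:R)); first by [].
rewrite -(subnKC nN); apply: le_trans (part _) _.
rewrite lerD2l ler_wpM2r//.
have : 0 <= (2^-1 : R) ^+ (N - n) by exact: exprn_ge0.
lra.
Unshelve. all: by end_near. Qed.

(** Dividing by 8 makes five terms of the exponential series accurate enough; the decimals raised to
    the eighth power bracket [2^(1/8) = 1.0905077...]. *)
Lemma ln2_bounds : (693 * 10 ^+ 3 + 145) / 10 ^+ 6 <= ln (2 : R) <= (693 * 10 ^+ 3 + 149) / 10 ^+ 6.
Proof.
have fE := (fact0, factS 0, factS 1, factS 2, factS 3, factS 4).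
apply/andP; split.
  rewrite -[X in X <= _]expRK ler_ln ?posrE ?expR_gt0//.
  rewrite (_ : (693 * 10 ^+ 3 + 145) / 10 ^+ 6 = 8%:R * ((693 * 10 ^+ 3 + 145) / (8 * 10 ^+ 6)) :> R); last by field.
  rewrite expRM_natl.
  have : expR ((693 * 10 ^+ 3 + 145) / (8 * 10 ^+ 6) : R) <= (10 * 10 ^+ 6 + 905 * 10 ^+ 3 + 76) / 10 ^+ 7.
    apply: le_trans (@expR_le_series _ 5 _) _; first by lra.
    rewrite !big_nat_recr//= big_geq//.
    rewrite !fE; lra.
  move=> h; have := expR_ge0 ((693 * 10 ^+ 3 + 145) / (8 * 10 ^+ 6) : R); move: (expR _) h => e h e0.
  have h2 : e ^+ 8 <= ((10 * 10 ^+ 6 + 905 * 10 ^+ 3 + 76) / 10 ^+ 7) ^+ 8 by exact: lerX_nneg.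
  apply: le_trans h2 _; lra.
rewrite -[X in _ <= X]expRK ler_ln ?posrE ?expR_gt0//.
rewrite (_ : (693 * 10 ^+ 3 + 149) / 10 ^+ 6 = 8%:R * ((693 * 10 ^+ 3 + 149) / (8 * 10 ^+ 6)) :> R); last by field.
rewrite expRM_natl.
have : (10 * 10 ^+ 6 + 905 * 10 ^+ 3 + 79) / 10 ^+ 7 <= expR ((693 * 10 ^+ 3 + 149) / (8 * 10 ^+ 6) : R).
  apply: le_trans (@expR_ge_series _ 5 _); last by lra.
  rewrite !big_nat_recr//= big_geq//.
  rewrite !fE; lra.
move=> h.
apply: le_trans (_ : ((10 * 10 ^+ 6 + 905 * 10 ^+ 3 + 79) / 10 ^+ 7) ^+ 8 <= _); first lra.
by apply: lerX_nneg h; lra.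
Qed.

Lemma ln_39_40_bounds : - ((25 * 10 ^+ 3 + 319) / 10 ^+ 6) <= ln (39 / 40 : R) <= - ((25 * 10 ^+ 3 + 316) / 10 ^+ 6).
Proof.
have fE := (fact0, factS 0, factS 1, factS 2, factS 3).
have -> : 39 / 40 = (40 / 39)^-1 :> R by field.
rewrite lnV ?posrE; last by lra.
rewrite !lerN2; apply/andP; split.
  rewrite -[X in _ <= X]expRK ler_ln ?posrE ?expR_gt0//.
  apply: le_trans (@expR_ge_series _ 4 _); last by lra.
  rewrite !big_nat_recr//= big_geq//.
  by rewrite !fE; lra.
rewrite -[X in X <= _]expRK ler_ln ?posrE ?expR_gt0//.
apply: le_trans (@expR_le_series _ 4 _) _; first by lra.
rewrite !big_nat_recr//= big_geq//.
by rewrite !fE; lra.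
Qed.

End numerics.

Section asymptotics.
Context {R : realType}.

Lemma le_phi_inv (B y : R) : 0 <= B <= 1 -> 0 <= y <= phi B -> B <= phi_inv y.
Proof.
move=> B01 /andP[y0 yB].
have /andP[_ f1] := phi_ge0_le1 B01.
have yI : y \in `[0, 1] by rewrite in_itv/= y0 (le_trans yB).
by rewrite -(le_nmono_in (@phi_decr R)) ?phi_invK ?phi_inv_itv ?in_itv.
Qed.

(** With [q] the square root, [W < a] amounts to [f^2 - 4 a f + 2 a g < f q]; on squaring, the gap
    is [4 a] times that of the last hypothesis. A nonpositive left side needs [q > 0]: [q = 0]
    forces [f = 4 a], which contradicts that hypothesis. *)
Lemma W_lt (a B : R) : 0 < a -> 4 * a <= phi B -> 0 <= phi (Num.min 1 (2 * B)) < phi B ->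
  a * (2 * phi B - phi (Num.min 1 (2 * B))) ^+ 2 <
    phi B ^+ 2 * (phi B - phi (Num.min 1 (2 * B))) ->
  W a B < a.
Proof.
rewrite /W; move: (phi _) (phi (Num.min _ _)) => f g a0 fa /andP[g0 gf] h.
have f0 : 0 < f by lra.
set q := Num.sqrt _.
have q0 : 0 <= q by exact: sqrtr_ge0.
have q2 : q ^+ 2 = f ^+ 2 - 4 * a * f by rewrite sqr_sqrtr//; nra.
have key : f ^+ 2 - 4 * a * f + 2 * a * g < f * q.
  have [X0|X0] := leP (f ^+ 2 - 4 * a * f + 2 * a * g) 0.
    apply: le_lt_trans X0 _; rewrite mulr_gt0// lt_neqAle q0 andbT eq_sym.
    apply/negP => /eqP q00; move: q2; rewrite q00 expr0n/= => E.
    have fE : f = 4 * a.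
      have : f * (f - 4 * a) = 0 by rewrite [RHS]E; ring.
      by move/eqP; rewrite mulf_eq0 gt_eqF//= subr_eq0 => /eqP.
    move: h; rewrite fE => h.
    have : a * (2 * (4 * a) - g) ^+ 2 - (4 * a) ^+ 2 * (4 * a - g) = a * g ^+ 2 by ring.
    have := mulr_ge0 (ltW a0) (sqr_ge0 g); lra.
  rewrite -ltr_sqr ?nnegrE ?(ltW X0) ?mulr_ge0 ?(ltW f0)// exprMn q2 -subr_gt0.
  have -> : f ^+ 2 * (f ^+ 2 - 4 * a * f) - (f ^+ 2 - 4 * a * f + 2 * a * g) ^+ 2 =
    4 * a * (f ^+ 2 * (f - g) - a * (2 * f - g) ^+ 2) by ring.
  by rewrite mulr_gt0 ?subr_gt0// mulr_gt0.
rewrite -(ltr_pM2r (_ : 0 < 4 * f)) ?mulr_gt0//.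
have -> : ((f - q) ^+ 2 / (4 * f) + a * (g / f)) * (4 * f) = (f - q) ^+ 2 + 4 * a * g.
  by field; rewrite gt_eqF.
have -> : (f - q) ^+ 2 = f ^+ 2 - 2 * f * q + q ^+ 2 by ring.
rewrite q2; lra.
Qed.

Lemma K_lt (a : R) : 0 < a <= (11 * 10 ^+ 3 + 717) / 10 ^+ 5 -> K a < a.
Proof.
move=> /andP[a0 a1].
(* Close to the maximum of the bound on [a] in [W_lt], about 0.117176, reached near 0.12175. *)
pose B : R := 39 / 320.
have [/andP[l2 l2'] /andP[lx lx']] := (@ln2_bounds R, @ln_39_40_bounds R).
(* Since [39 / 320 = (39 / 40) / 2^3], only [ln 2] and [ln (39 / 40)] are needed. The margin in [a]
   is a few millionths, hence the tight decimals. *)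
have lnB : ln B = ln (39 / 40) - 3 * ln 2.
  have -> : B = 39 / 40 / 2 ^+ 3 by rewrite /B; field.
  by rewrite ln_div ?posrE ?lnXn//; lra.
have ln2B : ln (2 * B) = ln (39 / 40) - 2 * ln 2.
  by rewrite lnM ?posrE ?lnB//; rewrite /B; lra.
have mE : Num.min 1 (2 * B) = 2 * B by rewrite min_r// /B; lra.
have fE := phiE B; rewrite lnB in fE; have gE := phiE (2 * B); rewrite ln2B in gE.
have BE : B = 39 / 320 by [].
have f1 : (6 * 10 ^+ 6 + 216 * 10 ^+ 3 + 66) / 10 ^+ 7 <= phi B by rewrite fE BE; lra.
have f2 : phi B <= (6 * 10 ^+ 6 + 216 * 10 ^+ 3 + 85) / 10 ^+ 7 by rewrite fE BE; lra.
have g1 : (4 * 10 ^+ 6 + 121 * 10 ^+ 3 + 683) / 10 ^+ 7 <= phi (2 * B) by rewrite gE BE; lra.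
have g2 : phi (2 * B) <= (4 * 10 ^+ 6 + 121 * 10 ^+ 3 + 711) / 10 ^+ 7 by rewrite gE BE; lra.
have B01 : 0 <= B <= 1 by rewrite BE; lra.
have fa : 4 * a <= phi B by lra.
have [|_ Kmin] := @K_min R a; first by apply/andP; split; lra.
apply: le_lt_trans (Kmin B _) _.
  by rewrite in_itv/= le_phi_inv ?andbT//; lra.
apply: W_lt => //; rewrite mE; first by lra.
move: (phi B) (phi (2 * B)) f1 f2 g1 g2 => f g f1 f2 g1 g2.
have h1 : (2 * f - g) ^+ 2 <= ((8 * 10 ^+ 6 + 310 * 10 ^+ 3 + 487) / 10 ^+ 7) ^+ 2 by apply: lerX_nneg; lra.
have h2 : ((6 * 10 ^+ 6 + 216 * 10 ^+ 3 + 66) / 10 ^+ 7) ^+ 2 <= f ^+ 2 by apply: lerX_nneg; lra.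
have h3 : ((6 * 10 ^+ 6 + 216 * 10 ^+ 3 + 66) / 10 ^+ 7) ^+ 2 * ((2 * 10 ^+ 6 + 94 * 10 ^+ 3 + 355) / 10 ^+ 7) <= f ^+ 2 * (f - g).
  by apply: ler_pM => //; rewrite ?sqr_ge0//; lra.
apply: lt_le_trans h3; apply: le_lt_trans (_ : (11 * 10 ^+ 3 + 717) / 10 ^+ 5 * ((8 * 10 ^+ 6 + 310 * 10 ^+ 3 + 487) / 10 ^+ 7) ^+ 2 < _).
  by apply: ler_pM; rewrite ?sqr_ge0 ?(ltW a0).
lra.
Qed.

Lemma phi_half : phi (1 / 2 : R) = (1 - ln 2) / 2.
Proof. by rewrite phiE div1r lnV ?posrE//; lra. Qed.

(** At [B = 1 / 2] the second term of [W] vanishes. With [r = a / f], the bound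
    [sqrt(f^2 - 4 a f) >= f - 2 a - 8 a r] leaves [(a^2 / f) (1 + 4 r)^2], and
    [8 r + 16 r^2 <= 12 r] for [r <= 1 / 4]. *)
Lemma W_half_le (a : R) : 0 < a -> 4 * a <= phi (1 / 2 : R) ->
  W a (1 / 2) <= a ^+ 2 / phi (1 / 2) + 12 / phi (1 / 2) ^+ 2 * a ^+ 3.
Proof.
rewrite /W (_ : 2 * (1 / 2) = 1 :> R); last by lra.
rewrite minxx phi1 mul0r mulr0 addr0; move: (phi _) => f a0 fa.
have f0 : 0 < f by lra.
set q := Num.sqrt _.
pose k := 8 * a ^+ 2 / f.
have r0 : 0 < a / f by rewrite divr_gt0.
have r4 : a / f <= 1 / 4 by rewrite ler_pdivrMr//; lra.
have kE : k = 8 * a * (a / f) by rewrite /k; ring.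
have aE : a = (a / f) * f by rewrite divfK// gt_eqF.
have qge : f - 2 * a - k <= q.
  apply: le_trans (ler_norm _) _; rewrite -sqrtr_sqr; apply: ler_wsqrtr.
  rewrite -subr_ge0 kE aE; move: (a / f) r0 r4 => r r0 r4.
  rewrite (_ : _ - _ = 4 * (r * f) ^+ 2 * (3 - 8 * r - 16 * r ^+ 2)).
    by rewrite mulr_ge0 ?mulr_ge0 ?sqr_ge0//; nra.
  by field; rewrite gt_eqF.
have qle : q <= f.
  rewrite -[X in _ <= X]ger0_norm ?(ltW f0)// -sqrtr_sqr; apply: ler_wsqrtr.
  by rewrite gerBl !mulr_ge0// ltW.
apply: le_trans (_ : (2 * a + k) ^+ 2 / (4 * f) <= _).
  rewrite ler_pM2r ?invr_gt0 ?mulr_gt0//.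
  by apply: lerX_nneg; lra.
rewrite kE -subr_ge0; rewrite aE; move: (a / f) r0 r4 => r r0 r4.
rewrite (_ : _ - _ = 4 * f * r ^+ 3 * (1 - 4 * r)).
  by rewrite !mulr_ge0 ?exprn_ge0 ?(ltW f0) ?(ltW r0)//; lra.
by field; rewrite gt_eqF.
Qed.

Lemma K_asymptotic : exists2 h : R -> R,
    h a / a ^+ 2 @[a --> 0^'+] --> 0
  & \forall a \near 0^'+, K a <= 2 * a ^+ 2 / (1 - ln 2) + h a.
Proof.
have f0 : 0 < phi (1 / 2 : R).
  by rewrite phi_half; have /andP[_] := @ln2_bounds R; lra.
exists (fun a => 12 / phi (1 / 2) ^+ 2 * a ^+ 3).
  have lim : 12 / phi (1 / 2 : R) ^+ 2 * a @[a --> 0^'+] --> (0 : R).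
    rewrite -[X in _ --> X](mulr0 (12 / phi (1 / 2 : R) ^+ 2)).
    apply: cvgM; first exact: cvg_cst.
    by apply: cvg_at_right_filter; exact: cvg_id.
  apply: cvg_trans lim; apply: near_eq_cvg; near=> a.
  have a0 : 0 < a by near: a; exact: nbhs_right_gt.
  by field; rewrite !gt_eqF.
near=> a.
have a0 : 0 < a by near: a; exact: nbhs_right_gt.
have a1 : a < phi (1 / 2) / 4.
  by near: a; apply: nbhs_right_lt; rewrite divr_gt0.
have fa : 4 * a <= phi (1 / 2 : R) by lra.
have h01 : 0 <= (1 / 2 : R) <= 1 by lra.
have /andP[_ f1] := phi_ge0_le1 h01.
have [|_ Kmin] := @K_min R a; first by apply/andP; split; lra.
apply: le_trans (Kmin (1 / 2) _) _.
  by rewrite in_itv/= le_phi_inv ?fa ?andbT//; lra.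
apply: le_trans (W_half_le a0 fa) _.
rewrite lerD2r phi_half le_eqVlt; apply/orP; left; apply/eqP; field.
by have := f0; rewrite phi_half; lra.
Unshelve. all: by end_near. Qed.

End asymptotics.

Theorem theorem1p1 (R : realType) :
  [/\ forall a : R, 0 < a < 1 / 4 -> (psi a <= (K a)%:E)%E,
      forall a : R, 0 < a <= (11 * 10 ^+ 3 + 717) / 10 ^+ 5 -> K a < a
    & exists2 h : R -> R,
        h a / a ^+ 2 @[a --> 0^'+] --> 0
      & \forall a \near 0^'+,
          K a <= 2 * a ^+ 2 / (1 - ln 2) + h a].
Proof.
split; [|exact: K_lt|exact: K_asymptotic].
move=> a a4; have [[B BI ->] _] := K_min a4.
exact: psi_le_W.
Qed.
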